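(* Let $1\le d<n$ be integers, let $y_1,\dots,y_n\in[0,1]$ and $G=[0,y_1]\times\cdots\times[0,y_n]$. Let $j_1,\dots,j_{n-d}\in\{1,\dots,d\}$, and for $k=1,\dots,n-d$ let $f_{d+k}:[0,y_{j_k}]\to[0,y_{d+k}]$ be a decreasing function. Let $$S=\{(s_1,\dots,s_n)\in G:\ s_{d+k}=f_{d+k}(s_{j_k}),\ k=1,\dots,n-d\}.$$ Suppose that there exist decreasing functions $z_i:[0,y_i]\to(0,\infty)$, $i=1,\dots,d$, such that $$\prod_{k=1}^{n-d}f_{d+k}(s_{j_k})=\prod_{i=1}^{d}z_i(s_i)\qquad\text{for all }(s_1,\dots,s_d)\in[0,y_1]\times\cdots\times[0,y_d].$$ For $i=1,\dots,d$ put $a_i(t)=\dfrac{t}{z_i(t)}$ for $t\in[0,y_i]$, $x_i=a_i(y_i)$, $I_i=[0,x_i]$, and let $D=I_1\times\cdots\times I_d$. Suppose that for every $i=1,\dots,d$ there exists $a_i^{-1}:I_i\to[0,y_i]$, the inverse of $a_i$. Let $X(s_1,\dots,s_n)$ be an $n$-parameter Brownian sheet on $G$, let $g:G\to\mathbb{R}$ be a continuous function, and let $$g_S(s_1,\dots,s_d)=g\bigl(s_1,\dots,s_d,f_{d+1}(s_{j_1}),\dots,f_n(s_{j_{n-d}})\bigr)$$ denote the restriction of $g$ to $S$. Then $$\mathsf{P}\Bigl\{\sup_{(s_1,\dots,s_n)\in S}\bigl(X(s_1,\dots,s_n)-g(s_1,\dots,s_n)\bigr)<0\Bigr\}=\mathsf{P}\Bigl\{\sup_{(t_1,\dots,t_d)\in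 D}\Bigl(X(t_1,\dots,t_d)-\frac{g_S\bigl(a_1^{-1}(t_1),\dots,a_d^{-1}(t_d)\bigr)}{z_1\bigl(a_1^{-1}(t_1)\bigr)\cdots z_d\bigl(a_d^{-1}(t_d)\bigr)}\Bigr)<0\Bigr\},$$ where on the right-hand side $X(t_1,\dots,t_d)$ denotes a $d$-parameter Brownian sheet on $D$.
   Context: For an integer $m\ge1$ and a set $T=T_1\times\cdots\times T_m$ with $T_i\subset[0,\infty)$ intervals, an $m$-parameter Brownian sheet on $T$ is a real-valued separable Gaussian field $\{X(s_1,\dots,s_m):(s_1,\dots,s_m)\in T\}$ such that: (1) $X(s_1,\dots,s_m)=0$ if $s_1\cdots s_m=0$; (2) $\mathsf{E}[X(s_1,\dots,s_m)]=0$ for all $(s_1,\dots,s_m)\in T$; (3) $\mathsf{E}[X(s_1,\dots,s_m)X(t_1,\dots,t_m)]=\prod_{i=1}^m\min\{s_i,t_i\}$ for all $(s_1,\dots,s_m),(t_1,\dots,t_m)\in T$. (Here intervals may be degenerate, i.e. single points.) *)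

(* Defs.v *)
From HB Require Import structures.
From mathcomp Require Import all_boot all_order all_algebra.
From mathcomp Require Import all_classical all_reals all_analysis.

Set Implicit Arguments.
Unset Strict Implicit.
Unset Printing Implicit Defensive.

Import Order.TTheory GRing.Theory Num.Theory.
Import numFieldNormedType.Exports.

Local Open Scope classical_set_scope.
Local Open Scope ring_scope.

Definition box (R : realType) (m : nat) (T : 'I_m -> set R) : set 'rV[R]_m :=
  [set s | forall i, T i (s ord0 i)].

(* Point masses count as Gaussian.  They are listed separately because
   normal_prob m 0 is not the point mass at m. *)
Definition gaussian_law (R : realType) (mu : set R -> \bar R) : Prop :=
  exists m s : R, forall A : set R, measurable A ->
    mu A = if s == 0 then \d_m A else normal_prob m s A.

Definition gaussian_field (R : realType) (dO : measure_display)
    (Omega : measurableType dO) (P : probability Omega R) (m : nat)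
    (T : set 'rV[R]_m) (X : 'rV[R]_m -> Omega -> R) : Prop :=
  (forall t, T t -> measurable_fun setT (X t)) /\
  (forall (k : nat) (t : 'I_k -> 'rV[R]_m) (c : 'I_k -> R),
     (forall l, T (t l)) ->
     gaussian_law
       (pushforward P (fun w => \sum_(l < k) c l * X (t l) w))).

(* Separability in the sense of Doob.  Of the two inclusions between
   {X_t \in B for all t in U, T} and {X_t \in B for all t in U, Q},
   only the one stated here is not immediate. *)
Definition separable_field (R : realType) (dO : measure_display)
    (Omega : measurableType dO) (P : probability Omega R) (m : nat)
    (T : set 'rV[R]_m) (X : 'rV[R]_m -> Omega -> R) : Prop :=
  exists (Q : set 'rV[R]_m) (N : set Omega),
    [/\ countable Q, Q `<=` T, T `<=` closure Q, P.-negligible N &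
      forall w, ~ N w -> forall (U : set 'rV[R]_m) (B : set R),
        open U -> closed B ->
        (forall t, U t -> Q t -> B (X t w)) ->
        forall t, U t -> T t -> B (X t w)].

(* The field is a total function on 'rV[R]_m; its values outside box T are
   unconstrained. *)
Record brownian_sheet (R : realType) (dO : measure_display)
    (Omega : measurableType dO) (P : probability Omega R) (m : nat)
    (T : 'I_m -> set R) (X : 'rV[R]_m -> Omega -> R) : Prop := BrownianSheet {
  bs_dim : (0 < m)%N ;
  bs_interval : forall i, is_interval (T i) ;
  bs_nonneg : forall i, T i `<=` `[0, +oo[ ;
  bs_gaussian : gaussian_field P (box T) X ;
  bs_separable : separable_field P (box T) X ;
  bs_zero : forall s, box T s -> \prod_(i < m) s ord0 i = 0 ->
    forall w, X s w = 0 ;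
  bs_mean : forall s, box T s -> 'E_P[X s]%E = 0%:E ;
  bs_cov : forall s t, box T s -> box T t ->
    'E_P[(fun w => X s w * X t w)%R]%E =
      (\prod_(i < m) Num.min (s ord0 i) (t ord0 i))%:E
}.

Definition inverse_on (R : realType) (A B : set R) (a b : R -> R) : Prop :=
  [/\ set_fun A B a, set_fun B A b,
      (forall s, A s -> b (a s) = s) & (forall t, B t -> a (b t) = t)].

Section SurfaceS.
Variables (R : realType) (d m : nat).
Variables (y : 'I_(d + m) -> R) (j : 'I_m -> 'I_d) (f : 'I_m -> R -> R).

(* Coordinate i <= d of an n-vector, n = d + m, has index lshift m i, and
   coordinate d + k has index rshift d k. *)
Definition boxG : set 'rV[R]_(d + m) := box (fun i => `[0, y i]%classic).

Definition setS : set 'rV[R]_(d + m) :=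
  [set s | boxG s /\
     forall k, s ord0 (rshift d k) = f k (s ord0 (lshift m (j k)))].

Definition restrS (g : 'rV[R]_(d + m) -> R) (s : 'rV[R]_d) : R :=
  g (row_mx s (\row_k f k (s ord0 (j k)))).

End SurfaceS.

Definition sup_lt0 (R : realType) (Omega : Type) (m : nat) (D : set 'rV[R]_m)
    (X : 'rV[R]_m -> Omega -> R) (h : 'rV[R]_m -> R) : set Omega :=
  [set w | (ereal_sup [set (X t w - h t)%:E | t in D] < 0)%E].

(* Events such as sup_lt0 are uncountable intersections; separability makes
   them measurable only up to a null set, that is, measurable for the
   completion of P.  By Caratheodory's theorem (P finite), that completion is
   the outer measure P^* on the P^*-measurable sets, and it coincides with P
   on measurable sets. *)
Definition completion_measurable (R : realType) (dO : measure_display)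
    (Omega : measurableType dO) (P : probability Omega R) (A : set Omega)
    : Prop :=
  ((P^*)%mu).-caratheodory A.

Definition completion_prob (R : realType) (dO : measure_display)
    (Omega : measurableType dO) (P : probability Omega R) (A : set Omega)
    : \bar R :=
  completed_measure_extension (mu := P) A.

(* Main.v *)
(* Restricting the sheet to the surface [S] and dividing by [z_1 ... z_d] gives,
   after the time change [t_i = a_i (s_i)], a centered Gaussian field on [D] with
   the covariance of the [d]-parameter sheet: since [f_k] is decreasing,
   [min (f_k u) (f_k v) = f_k (max u v)], and the product formula trades the
   [f_k] for the [z_i].  Two such fields have the same finite-dimensional laws;
   for this, trigonometric polynomials, on which the laws of linear combinations
   decide, are shown to approximate indicators of orthants boundedly.  The
   suprema are then compared along a dense sequence: a separable sheet has
   continuous paths almost surely (dyadic chaining, with Doob's condition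
   passing from the separant to all points), and [z_i], [f_k] are continuous
   away from [0] because [a_i] is a monotone bijection.  At [s_i = 0] they may
   jump, but there both sheets vanish and the constraint is deterministic. *)

Require Import Defs.
From HB Require Import structures.
From mathcomp Require Import all_boot all_order all_algebra.
From mathcomp Require Import all_classical all_reals all_analysis.
From mathcomp Require Import measurable_realfun ring lra.

Set Implicit Arguments.
Unset Strict Implicit.
Unset Printing Implicit Defensive.

Import Order.TTheory GRing.Theory Num.Theory.
Import numFieldNormedType.Exports.

Local Open Scope classical_set_scope.
Local Open Scope ring_scope.

(** * Integrals against Gaussian laws *)

(** The two sheets may live on different probability spaces, so only finite-dimensional laws can be
    compared; whatever involves uncountably many points has to be settled almost surely on each
    side. To make the comparison direct, both fields are indexed by the same [s] in the original
    box: [X] is read at [surface_pt s], and [X'] at [time_change s] is multiplied by [weight s], so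
    that both face the same barrier [g (surface_pt s)]. The weight is bounded above and away from
    [0], hence this does not change whether the supremum is negative. A negative supremum is the
    increasing union over [n] of the non-strict bounds by [- 1 / (n + 1)]; unlike the strict
    inequality, each of these passes from a dense sequence to its limits. No continuity of [f_k] or
    [z_i] is assumed. That of [z_i] comes from surjectivity of [a_i]; that of [f_k] comes from the
    product formula, where the cofactor of [f_k] is itself nonincreasing, so that a jump of [f_k]
    could not be compensated and would show up in [z_i]. *)

Section GaussianLaws.
Variable R : realType.
Local Notation mu := (@lebesgue_measure R).
Local Notation gamma := (@normal_prob R 0 1).

(** The Radon-Nikodym derivative is determined almost everywhere only; it agrees there with
    [normal_pdf] because both have the same integral over every measurable set. *)
Lemma ge0_integral_normal_prob (m s : R) (f : R -> \bar R) :
  measurable_fun [set: R] f -> (forall x, (0 <= f x)%E) ->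
  (\int[normal_prob m s]_x f x = \int[mu]_x (f x * (normal_pdf m s x)%:E))%E.
Proof.
move=> mf f0.
have dom := normal_prob_dominates m s.
rewrite -(@Radon_Nikodym_SigmaFinite.change_of_variables _ _ _
  (normal_prob m s) mu dom)//.
apply: ge0_ae_eq_integral => //.
- apply: emeasurable_funM => //; apply: (measurable_int mu).
  exact: Radon_Nikodym_SigmaFinite.f_integrable.
- apply: emeasurable_funM => //; apply/measurable_EFinP.
  exact: measurable_normal_pdf.
- by move=> x _; rewrite mule_ge0// Radon_Nikodym_SigmaFinite.f_ge0.
- by move=> x _; rewrite mule_ge0// lee_fin normal_pdf_ge0.
apply: ae_eqe_mul2l; apply: integral_ae_eq => //.
- exact: Radon_Nikodym_SigmaFinite.f_integrable.
- by apply/measurable_EFinP; exact: measurable_normal_pdf.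
- move=> E _ mE; rewrite -Radon_Nikodym_SigmaFinite.f_integral//.
Qed.

Lemma normal_pdf_affine (m s u : R) : s != 0 ->
  normal_pdf m s (m + `|s| * u) * `|s| = normal_pdf 0 1 u.
Proof.
move=> s0; rewrite !normal_pdfE ?oner_eq0//.
rewrite /normal_fun /normal_peak mulrAC; congr (_ * _).
  rewrite expr1n mul1r -mulrnAr sqrtrM ?sqr_ge0// invfM sqrtr_sqr.
  by rewrite mulrC mulrA mulfV ?normr_eq0// mul1r.
congr expR; rewrite subr0 addrC addKr exprMn real_normK ?num_real//.
by rewrite expr1n; field.
Qed.

Lemma continuous_affine (m s : R) : continuous (fun u : R => m + s * u).
Proof.
by move=> u; apply: cvgD; [exact: cvg_cst|apply: cvgM; [exact: cvg_cst|exact: cvg_id]].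
Qed.

Lemma derivable_affine (m s x : R) :
  is_derive x 1 (fun u : R => m + s * u) s.
Proof.
rewrite (_ : (fun u : R => m + s * u) = (cst m + (s \*: id))%R); last first.
  by apply/funext => u.
by apply: is_derive_eq; rewrite add0r scaler1.
Qed.

Lemma integral_normal_prob_affine (m s : R) (f : R -> R) : s != 0 ->
  continuous f -> (forall x, 0 <= f x) ->
  (\int[normal_prob m s]_x (f x)%:E =
   \int[gamma]_u (f (m + `|s| * u))%:E)%E.
Proof.
move=> s0 cf f0.
have ns0 : 0 < `|s| by rewrite normr_gt0.
have ca := @continuous_affine m `|s|.
have cfa : continuous (fun u : R => f (m + `|s| * u)).
  by move=> u; apply: (cvg_comp _ f); [exact: ca|exact: cf].
have mE (h : R -> R) : continuous h -> measurable_fun [set: R] (EFin \o h).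
  by move=> ch; apply/measurable_EFinP; exact: continuous_measurable_fun.
rewrite (ge0_integral_normal_prob _ _ (mE _ cf))//.
rewrite (ge0_integral_normal_prob _ _ (mE _ cfa))//; last first.
  by move=> x; rewrite lee_fin.
under eq_integral do rewrite -EFinM.
have F' : derive1 (fun u : R => m + `|s| * u) = cst `|s|.
  apply/funext => x; rewrite derive1E; apply: derive_val.
  exact: derivable_affine.
rewrite (@increasing_ge0_integration_by_substitutionT _
  (fun u => m + `|s| * u) (fun x => f x * normal_pdf m s x))//.
- apply: eq_integral => x _; rewrite /= F' /= -EFinM; congr (_%:E).
  by rewrite -(normal_pdf_affine m _ s0) mulrA.
- by move=> x y xy; rewrite ltrD2l ltr_pM2l.
- by rewrite F'; exact: cst_continuous.
- by rewrite F'; exact: is_cvg_cst.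
- by rewrite F'; exact: is_cvg_cst.
- under eq_fun do rewrite addrC mulrC.
  by apply: (cvg_comp _ (fun x => x + m)); [apply: gt0_cvgMlNy => //|exact: cvg_addrr_Ny].
- under eq_fun do rewrite addrC mulrC.
  by apply: (cvg_comp _ (fun x => x + m)); [apply: gt0_cvgMly => //|exact: cvg_addrr].
- by move=> x; apply: cvgM; [exact: cf|exact: continuous_normal_pdf].
- by move=> x; rewrite mulr_ge0// normal_pdf_ge0.
Qed.

(** The parameter [s] of [gaussian_law] may be negative, but the density depends on its square, so
    [|s|] serves as well. For [s = 0] the affine map is constant, which brings point masses and
    densities under one formula. *)
Lemma gaussian_law_standardize (d : measure_display) (Om : measurableType d)
    (P : probability Om R) (U : Om -> R) :
  measurable_fun setT U -> gaussian_law (pushforward P U) ->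
  exists2 ms : R * R, 0 <= ms.2 & forall f : R -> R, continuous f ->
    (forall x, 0 <= f x) ->
    (\int[P]_w (f (U w))%:E = \int[gamma]_u (f (ms.1 + ms.2 * u))%:E)%E.
Proof.
move=> mU [m [s H]]; exists (m, `|s|) => [|f cf f0] /=; first exact: normr_ge0.
have mf : measurable_fun setT f by exact: continuous_measurable_fun.
have mU' : measurable_fun setT (U : Om -> measurableTypeR R) by exact: mU.
transitivity (\int[pushforward P (U : Om -> measurableTypeR R)]_x (f x)%:E)%E.
  by rewrite ge0_integral_pushforward//; [exact/measurable_EFinP|
    move=> x _; rewrite lee_fin].
have [s0|s0] := eqVneq s 0.
  rewrite [LHS](eq_measure_integral (\d_(m : measurableTypeR R) :
    {measure set (measurableTypeR R) -> \bar R})); last first.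
    by move=> A mA _; have := H A mA; rewrite s0 eqxx.
  rewrite integral_dirac//; last exact/measurable_EFinP.
  rewrite diracT mul1e s0 normr0.
  under eq_integral do rewrite mul0r addr0.
  by rewrite integral_cst//= probability_setT mule1.
rewrite [LHS](eq_measure_integral (normal_prob m s)); last first.
  by move=> A mA _; have := H A mA; rewrite (negbTE s0).
exact: integral_normal_prob_affine.
Qed.

End GaussianLaws.

(** * Moments of the standard normal law *)

Section GaussianMoments.
Variable R : realType.
Local Notation mu := (@lebesgue_measure R).
Local Notation gamma := (@normal_prob R 0 1).

Lemma exprn_le_expR (x : R) n : 0 <= x -> x ^+ n <= n`!%:R * expR x.
Proof.
move=> x0; case: n => [|n].
  by rewrite expr0 fact0 mul1r -[leLHS]expR0 ler_expR.
rewrite mulrC -ler_pdivrMr ?ltr0n ?fact_gt0//.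
by rewrite (le_trans _ (expR_ge1Dxn n x0))// lerDr.
Qed.

(** The factor changes the exponent [- u ^+ 2 / 2] of the density into [- u ^+ 2 / 4], which up to
    the ratio [c] of the peaks is the normal density of variance [2]. *)
Lemma gamma_expR_sqr4_lty :
  (\int[gamma]_u (expR (u ^+ 2 / 4))%:E < +oo)%E.
Proof.
have s2 : Num.sqrt 2 != 0 :> R by rewrite gt_eqF// sqrtr_gt0.
have cf : continuous (fun u : R => expR (u ^+ 2 / 4)).
  move=> u; apply: (cvg_comp _ expR); last exact: continuous_expR.
  by apply: cvgM; [exact: exprn_continuous|exact: cvg_cst].
rewrite ge0_integral_normal_prob; last 2 first.
- by apply/measurable_EFinP; exact: continuous_measurable_fun.
- by move=> x; rewrite lee_fin expR_ge0.
pose c : R := normal_peak 1 / normal_peak (Num.sqrt 2).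
have -> : (\int[mu]_x ((expR (x ^+ 2 / 4))%:E * (normal_pdf 0 1 x)%:E) =
    \int[mu]_x (c%:E * (normal_pdf 0 (Num.sqrt 2) x)%:E))%E.
  apply: eq_integral => x _; rewrite -!EFinM; congr (_%:E).
  rewrite !normal_pdfE ?oner_eq0// /c [RHS]mulrA divfK ?gt_eqF ?normal_peak_gt0//.
  rewrite mulrCA -expRD; congr (_ * expR _).
  by rewrite subr0 expr1n sqr_sqrtr//; field.
rewrite ge0_integralZl//; last 3 first.
- by apply/measurable_EFinP; exact: measurable_normal_pdf.
- by move=> x _; rewrite lee_fin normal_pdf_ge0.
- by rewrite lee_fin divr_ge0// normal_peak_ge0.
by rewrite integral_normal_pdf mule1 ltry.
Qed.

Lemma gamma_integrable_exprn n :
  gamma.-integrable setT (fun u => (u ^+ n)%:E).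
Proof.
have mX k : measurable_fun [set: R] (fun u : R => (u ^+ k)%:E).
  by apply/measurable_EFinP; exact: measurable_funX.
apply/integrableP; split; first exact: mX.
(* With [t = u ^+ 2 / 4], the bound of [t ^+ n] by the exponential gives the term with [4 ^+ n]; the
   summand [1] pays for bounding [|u| ^+ n] by [1 + u ^+ (2 * n)]. *)
pose c : R := 1 + 4 ^+ n * n`!%:R.
apply: (@le_lt_trans _ _ (\int[gamma]_u (c%:E * (expR (u ^+ 2 / 4))%:E))%E).
  apply: ge0_le_integral => //.
  - by apply: measurableT_comp => //; exact: mX.
  - apply/measurable_EFinP; apply: measurable_funM => //.
    by apply: measurableT_comp => //; apply: measurable_funM => //; exact: measurable_funX.
  move=> u _; rewrite -EFinM lee_fin.
  have t0 : 0 <= u ^+ 2 / 4 by rewrite divr_ge0// sqr_ge0.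
  have e1 : 1 <= expR (u ^+ 2 / 4) by rewrite -[leLHS]expR0 ler_expR.
  have h : u ^+ (2 * n) <= 4 ^+ n * n`!%:R * expR (u ^+ 2 / 4).
    have := exprn_le_expR n t0; rewrite expr_div_n -exprM.
    by rewrite ler_pdivrMr ?exprn_gt0// => /le_trans; apply; rewrite -mulrA mulrC.
  rewrite /c mulrDl mul1r normrX.
  apply: le_trans (lerD e1 h).
  have : 0 <= (1 - `|u| ^+ n) ^+ 2 by exact: sqr_ge0.
  have : u ^+ (2 * n) = (`|u| ^+ n) ^+ 2.
    by rewrite -normrX real_normK ?num_real// -exprM mulnC.
  by move=> ->; nra.
rewrite ge0_integralZl//.
- apply: lte_mul_pinfty => //; last exact: gamma_expR_sqr4_lty.
  by rewrite lee_fin addr_ge0// mulr_ge0// exprn_ge0.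
- apply/measurable_EFinP.
  by apply: measurableT_comp => //; apply: measurable_funM => //; exact: measurable_funX.
- by rewrite lee_fin addr_ge0// mulr_ge0// exprn_ge0.
Qed.

Lemma gamma_symmetric (f : R -> \bar R) : measurable_fun [set: R] f ->
  (forall x, (0 <= f x)%E) -> (\int[gamma]_u f (- u)%R = \int[gamma]_u f u)%E.
Proof.
move=> mf f0.
have mN : measurable_fun [set: R] (fun u : R => f (- u)).
  by apply: measurableT_comp => //; exact: oppr_measurable.
rewrite !ge0_integral_normal_prob//.
have mg : measurable_fun [set: measurableTypeR R]
    (fun x => f x * (normal_pdf 0 1 x)%:E)%E.
  by apply: emeasurable_funM => //; apply/measurable_EFinP; exact: measurable_normal_pdf.
transitivity (\int[pushforward mu (-%R : _ -> measurableTypeR R)]_x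
    (f x * (normal_pdf 0 1 x)%:E))%E; last first.
  by apply: eq_measure_integral => A mA _; exact: lebesgue_measureN.
rewrite ge0_integral_pushforward//; last first.
  by move=> x _; rewrite mule_ge0// lee_fin normal_pdf_ge0.
apply: eq_integral => x _ /=; congr (_ * _%:E)%E.
by rewrite !normal_pdfE ?oner_eq0// /normal_fun !subr0 sqrrN.
Qed.

(** The reflection [u -> - u] exchanges the positive and negative parts; integrability makes their
    integrals finite, so the difference is a true zero. *)
Lemma gamma_mean0 : (\int[gamma]_u u%:E = 0)%E.
Proof.
have i1 : gamma.-integrable setT (EFin : R -> \bar R).
  by have := gamma_integrable_exprn 1; apply: eq_integrable.
rewrite integralE.
have -> : (\int[gamma]_u (EFin : R -> \bar R)^\- u =
           \int[gamma]_u (EFin : R -> \bar R)^\+ u)%E.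
  rewrite -[RHS]gamma_symmetric//.
    by apply: eq_integral => u _; rewrite funenegE funeposE EFinN.
  by apply: measurable_funepos; exact: (measurable_int _ i1).
rewrite subee//.
by apply: integrable_pos_fin_num.
Qed.

Definition gamma_moment n : R := fine (\int[gamma]_u (u ^+ n)%:E)%E.

Lemma gamma_momentE n : (\int[gamma]_u (u ^+ n)%:E = (gamma_moment n)%:E)%E.
Proof.
rewrite fineK//; apply: integrable_fin_num => //.
exact: gamma_integrable_exprn.
Qed.

(** Otherwise [u ^+ 2] would vanish almost everywhere and all the mass would sit at [0], which
    absolute continuity with respect to Lebesgue measure excludes. *)
Lemma gamma_moment2_gt0 : 0 < gamma_moment 2.
Proof.
rewrite -lte_fin -gamma_momentE lt_neqAle; apply/andP; split; last first.
  by apply: integral_ge0 => x _; rewrite lee_fin sqr_ge0.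
apply/negP => /eqP/esym h0.
have mX : measurable_fun [set: R] (fun u : R => (u ^+ 2)%:E).
  by apply/measurable_EFinP; exact: measurable_funX.
have : (\int[gamma]_u `|(u ^+ 2)%:E| = 0)%E.
  by rewrite -[RHS]h0; apply: eq_integral => u _; rewrite gee0_abs// lee_fin sqr_ge0.
move/ae_eq_integral_abs => /(_ measurableT mX) [A [mA A0 sA]].
have m0 : measurable [set (0 : R)] by exact: measurable_set1.
have : gamma setT = 0%E.
  apply/eqP; rewrite eq_le measure_ge0 andbT.
  apply: (@le_trans _ _ (gamma (A `|` [set 0]))).
    apply: le_measure; rewrite ?inE//; first exact: measurableU.
    move=> u _; have [->|u0] := eqVneq u 0; [by right|left].
    apply: sA => /= /(_ I) [] /eqP; rewrite sqrf_eq0 => /eqP u00.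
    by rewrite u00 eqxx in u0.
  rewrite (le_trans (measureU2 _ mA m0))//= A0 add0e.
  have := normal_prob_dominates (0 : R) 1.
  move/null_content_dominatesP => /(_ _ m0) ->//.
  exact: lebesgue_measure_set1.
by rewrite probability_setT => /eqP; rewrite onee_eq0.
Qed.

End GaussianMoments.

(** * Centered Gaussian laws and their variance *)

Section CenteredGaussianLaws.
Variable R : realType.
Local Notation gamma := (@normal_prob R 0 1).

Lemma gaussian_law_integral (d : measure_display) (Om : measurableType d)
    (P : probability Om R) (U : Om -> R) :
  measurable_fun setT U -> gaussian_law (pushforward P U) ->
  exists2 ms : R * R, 0 <= ms.2 & forall f : R -> R, continuous f ->
    (\int[P]_w (f (U w))%:E = \int[gamma]_u (f (ms.1 + ms.2 * u))%:E)%E.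
Proof.
move=> mU gU; have [ms ms0 H] := gaussian_law_standardize mU gU.
exists ms => // f cf; rewrite integralE [RHS]integralE.
congr (_ - _)%E.
- transitivity (\int[P]_w (Num.max (f (U w)) 0)%:E)%E.
    by apply: eq_integral => x _; rewrite funeposE EFin_max.
  rewrite (H (fun x => Num.max (f x) 0)).
  + by apply: eq_integral => x _; rewrite funeposE EFin_max.
  + move=> x; apply: (@continuous_max _ _ f (cst 0)); first exact: cf.
    exact: cvg_cst.
  + by move=> x; rewrite le_max lexx orbT.
- transitivity (\int[P]_w (Num.max (- f (U w)) 0)%:E)%E.
    by apply: eq_integral => x _; rewrite funenegE EFin_max.
  rewrite (H (fun x => Num.max (- f x) 0)).
  + by apply: eq_integral => x _; rewrite funenegE EFin_max.
  + move=> x; apply: (@continuous_max _ _ (fun x => - f x) (cst 0)).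
      by apply: (@cvgN _ R^o); exact: cf.
    exact: cvg_cst.
  + by move=> x; rewrite le_max lexx orbT.
Qed.

Lemma gaussian_law_L2 (d : measure_display) (Om : measurableType d)
    (P : probability Om R) (U : Om -> R) :
  measurable_fun setT U -> gaussian_law (pushforward P U) ->
  P.-integrable setT (fun w => (U w ^+ 2)%:E).
Proof.
move=> mU gU; have [[m s] /= s0 H] := gaussian_law_integral mU gU.
apply/integrableP; split.
  by apply/measurable_EFinP; exact: measurable_funX.
have -> : (\int[P]_w `|(U w ^+ 2)%:E| = \int[P]_w (U w ^+ 2)%:E)%E.
  by apply: eq_integral => w _; rewrite gee0_abs// lee_fin sqr_ge0.
rewrite (H (fun x => x ^+ 2)); last exact: exprn_continuous.
have -> : (\int[gamma]_u ((m + s * u) ^+ 2)%:E = \int[gamma]_u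
    ((m ^+ 2)%:E + (2 * m * s)%:E * (u ^+ 1)%:E + (s ^+ 2)%:E * (u ^+ 2)%:E))%E.
  by apply: eq_integral => u _; rewrite -!EFinM -!EFinD; congr (_%:E); ring.
apply: integrable_lty => //.
apply: integrableD => //.
  apply: integrableD => //.
    exact: finite_measure_integrable_cst.
  by apply: integrableZl => //; exact: gamma_integrable_exprn.
by apply: integrableZl => //; exact: gamma_integrable_exprn.
Qed.

Lemma centered_gaussian_law (d : measure_display) (Om : measurableType d)
    (P : probability Om R) (U : Om -> R) :
  measurable_fun setT U -> gaussian_law (pushforward P U) ->
  (\int[P]_w (U w)%:E = 0)%E ->
  exists2 s : R, 0 <= s & forall f : R -> R, continuous f ->
    (\int[P]_w (f (U w))%:E = \int[gamma]_u (f (s * u))%:E)%E.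
Proof.
move=> mU gU U0; have [[m s] /= s0 H] := gaussian_law_integral mU gU.
exists s => // f cf; rewrite (H f cf).
have : (\int[P]_w (U w)%:E = m%:E)%E.
  rewrite (H id); last by move=> x; exact: cvg_id.
  under eq_integral do rewrite EFinD EFinM.
  have i1 : gamma.-integrable setT (EFin : R -> \bar R).
    by have := gamma_integrable_exprn R 1; apply: eq_integrable.
  rewrite integralD//; last 2 first.
  - exact: finite_measure_integrable_cst.
  - exact: integrableZl.
  rewrite integralZl// gamma_mean0 mule0 adde0.
  by rewrite integral_cst//= probability_setT mule1.
by rewrite U0 => -[<-]; under eq_integral do rewrite add0r.
Qed.

(** [U] has the law of [s] times a standard normal variable, and [v] fixes [s ^+ 2]. Only the power
    [v ^+ q] matters for chaining, so the constant is left as a ratio of moments. *)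
Lemma centered_gaussian_moment (d : measure_display) (Om : measurableType d)
    (P : probability Om R) (U : Om -> R) (v : R) q :
  measurable_fun setT U -> gaussian_law (pushforward P U) ->
  (\int[P]_w (U w)%:E = 0)%E -> (\int[P]_w (U w ^+ 2)%:E = v%:E)%E ->
  (\int[P]_w (U w ^+ (2 * q))%:E =
    (gamma_moment R (2 * q) / gamma_moment R 2 ^+ q * v ^+ q)%:E)%E.
Proof.
move=> mU gU U0 Uv; have [s s0 H] := centered_gaussian_law mU gU U0.
have M n : (\int[P]_w (U w ^+ n)%:E = (s ^+ n * gamma_moment R n)%:E)%E.
  rewrite (H (fun x => x ^+ n)); last exact: exprn_continuous.
  under eq_integral do rewrite exprMn EFinM.
  rewrite integralZl//; last exact: gamma_integrable_exprn.
  by rewrite gamma_momentE.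
have := M 2%N; rewrite Uv => -[->]; rewrite M; congr (_%:E).
have k0 : gamma_moment R 2 ^+ q != 0.
  by rewrite expf_neq0// gt_eqF// gamma_moment2_gt0.
by rewrite exprMn -exprM [RHS]mulrCA divfK.
Qed.

Lemma centered_gaussian_law_eq (d d' : measure_display)
    (Om : measurableType d) (Om' : measurableType d')
    (P : probability Om R) (P' : probability Om' R)
    (U : Om -> R) (U' : Om' -> R) :
  measurable_fun setT U -> gaussian_law (pushforward P U) ->
  measurable_fun setT U' -> gaussian_law (pushforward P' U') ->
  (\int[P]_w (U w)%:E = 0)%E -> (\int[P']_w (U' w)%:E = 0)%E ->
  (\int[P]_w (U w ^+ 2)%:E = \int[P']_w (U' w ^+ 2)%:E)%E ->
  forall f : R -> R, continuous f ->
    (\int[P]_w (f (U w))%:E = \int[P']_w (f (U' w))%:E)%E.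
Proof.
move=> mU gU mU' gU' U0 U'0.
have [s s0 H] := centered_gaussian_law mU gU U0.
have [s' s'0 H'] := centered_gaussian_law mU' gU' U'0.
rewrite (H (fun x => x ^+ 2)); last exact: exprn_continuous.
rewrite (H' (fun x => x ^+ 2)); last exact: exprn_continuous.
under eq_integral do rewrite exprMn EFinM.
under [RHS]eq_integral do rewrite exprMn EFinM.
rewrite !integralZl//; try exact: gamma_integrable_exprn.
rewrite gamma_momentE -!EFinM => -[] /(mulIf _) ss.
have /eqP : s ^+ 2 = s' ^+ 2 by apply: ss; rewrite gt_eqF// gamma_moment2_gt0.
rewrite eqrXn2// => /eqP ss' f cf.
by rewrite H// H'// ss'.
Qed.

End CenteredGaussianLaws.

(** * Finite-dimensional laws *)

Section SoftThreshold.
Variable R : realType.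

Lemma bernoulli_le (h : R) n : -1 <= h -> 1 + n%:R * h <= (1 + h) ^+ n.
Proof.
move=> h1; elim: n => [|n IH]; first by rewrite mul0r addr0 expr0.
have h0 : 0 <= 1 + h by lra.
rewrite exprS; apply: le_trans (ler_wpM2l h0 IH).
rewrite -natr1; have : 0 <= n%:R * h ^+ 2 by rewrite mulr_ge0// sqr_ge0.
nra.
Qed.

Lemma cvg_natrM_exprn (x : R) : 0 <= x < 1 ->
  n%:R * x ^+ n @[n --> \oo] --> 0.
Proof.
(* Since [x <= r ^+ 2], the term [x ^+ n] splits into two factors [r ^+ n]: one absorbs [n], by
   Bernoulli's inequality for the powers of [r^-1], and the other tends to [0]. *)
move=> /andP[x0 x1]; pose r := (1 + x) / 2.
have r0 : 0 < r by rewrite /r; lra.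
have r1 : r < 1 by rewrite /r; lra.
have xr : x <= r ^+ 2.
  by have := sqr_ge0 (1 - x); rewrite /r; nra.
have h0 : 0 < r^-1 - 1 by rewrite subr_gt0 invf_gt1.
have cr : (r^-1 - 1)^-1 * r ^+ n @[n --> \oo] --> 0.
  rewrite -[X in _ --> X](mulr0 (r^-1 - 1)^-1); apply: cvgM; first exact: cvg_cst.
  by apply: cvg_expr; rewrite ger0_norm ?ltW.
apply: (@squeeze_cvgr _ _ _ _ (cst 0) (fun n => (r^-1 - 1)^-1 * r ^+ n)) => //;
  last exact: cvg_cst.
apply: nearW => n; rewrite mulr_ge0 ?exprn_ge0//=.
have rn0 : 0 < r ^+ n by rewrite exprn_gt0.
have nb : n%:R * r ^+ n <= (r^-1 - 1)^-1.
  have h1 : -1 <= r^-1 - 1 by lra.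
  have := bernoulli_le n h1; rewrite (_ : 1 + (r^-1 - 1) = r^-1); last by ring.
  rewrite exprVn => hb; rewrite -[leRHS]div1r ler_pdivlMr// mulrAC.
  by rewrite -ler_pdivlMr// div1r; lra.
apply: (@le_trans _ _ (n%:R * (r ^+ n * r ^+ n))).
  rewrite ler_wpM2l// -exprD addnn -mul2n exprM.
  by rewrite lerXn2r// ?nnegrE// exprn_ge0// ltW.
by rewrite mulrA ler_wpM2r// ltW.
Qed.

(** A variant of the polynomial step in the Brosowski-Deutsch proof of the Stone-Weierstrass
    theorem. The factor [2 ^ n] puts the threshold at [1 / 2]; the extra factor [n] makes [n (2u)^n]
    diverge also at [u = 1 / 2], so that the limit is the indicator of a closed half-line. *)
Definition soft_step n (u : R) : R := 1 - (1 - u ^+ n) ^+ (n * 2 ^ n).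

Lemma soft_step_bounds n u : 0 <= u <= 1 -> 0 <= soft_step n u <= 1.
Proof.
move=> /andP[u0 u1]; have un0 := exprn_ge0 n u0; have un1 := exprn_ile1 n u0 u1.
have v0 : 0 <= 1 - u ^+ n by lra.
have v1 : 1 - u ^+ n <= 1 by lra.
have := exprn_ge0 (n * 2 ^ n) v0; have := exprn_ile1 (n * 2 ^ n) v0 v1.
by rewrite /soft_step; lra.
Qed.

(* Bernoulli's inequality gives [soft_step n u <= n (2u)^n] on one side and
   [1 - soft_step n u <= 1 / (1 + n (2u)^n)] on the other. *)
Lemma soft_step_cvg (u : R) : 0 <= u <= 1 ->
  soft_step n u @[n --> \oo] --> ((1 / 2 <= u)%R%:R : R).
Proof.
move=> /andP[u0 u1].
have un0 n : 0 <= u ^+ n by exact: exprn_ge0.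
have un1 n : u ^+ n <= 1 by exact: exprn_ile1.
have sb n : 0 <= soft_step n u <= 1 by apply: soft_step_bounds; rewrite u0.
have [hu|hu] := leP (1 / 2) u.
  apply: (@squeeze_cvgr _ _ _ _ (fun n => 1 - harmonic n) (cst 1)) => //.
  - apply: nearW => n; have /andP[_ ->] := sb n; rewrite andbT.
    rewrite /soft_step lerD2l lerN2 /harmonic /=.
    rewrite -[leRHS]mul1r ler_pdivlMr ?ltr0n//.
    apply: (@le_trans _ _ ((1 - u ^+ n) ^+ (n * 2 ^ n) *
                           (1 + u ^+ n) ^+ (n * 2 ^ n))).
      rewrite ler_wpM2l ?exprn_ge0 ?subr_ge0//.
      apply: le_trans (bernoulli_le (n * 2 ^ n) _); last by have := un0 n; lra.
      rewrite -natr1 addrC lerD2l natrM -mulrA ler_peMr// natrX -exprMn.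
      by apply: exprn_ege1; lra.
    rewrite -exprMn; apply: exprn_ile1; last by have := un0 n; nra.
    by have := un0 n; have := un1 n; nra.
  - rewrite -[X in _ --> X]subr0; apply: cvgB; first exact: cvg_cst.
    exact: cvg_harmonic.
  - exact: cvg_cst.
apply: (@squeeze_cvgr _ _ _ _ (cst 0) (fun n => n%:R * (2 * u) ^+ n)) => //.
- apply: nearW => n; have /andP[-> _] /= := sb n.
  rewrite /soft_step.
  have := @bernoulli_le (- u ^+ n) (n * 2 ^ n).
  rewrite lerN2 => /(_ (un1 n)); rewrite natrM natrX exprMn.
  lra.
- exact: cvg_cst.
- by apply: cvg_natrM_exprn; lra.
Qed.

End SoftThreshold.

(** * Trigonometric polynomials and orthant probabilities *)

Section CramerWold.
Variable R : realType.

(** The phase [t] makes cosines cover sines and constants. Each generator depends on a single linear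
    combination of the coordinates, which is all that the laws of linear combinations can see;
    products stay in the class by the product-to-sum formula. *)
Inductive trig_poly n : (('I_n -> R) -> R) -> Prop :=
| trig_cos a c t :
    trig_poly (fun y => a * cos (\sum_(l < n) c l * y l + t))
| trig_add F G : trig_poly F -> trig_poly G -> trig_poly (fun y => F y + G y).

Lemma trig_mul n (F G : ('I_n -> R) -> R) :
  trig_poly F -> trig_poly G -> trig_poly (fun y => F y * G y).
Proof.
move=> tF; elim: tF G => [a c t G tG|F1 F2 _ IH1 _ IH2 G tG].
  elim: tG => [b e r|G1 G2 _ IH1 _ IH2].
    rewrite (_ : (fun _ => _) = (fun y =>
      (a * b / 2) * cos (\sum_(l < n) (c l + e l) * y l + (t + r)) +
      (a * b / 2) * cos (\sum_(l < n) (c l - e l) * y l + (t - r)))).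
      by apply: trig_add; exact: trig_cos.
    apply/funext => y.
    under [in X in _ = X + _]eq_bigr do rewrite mulrDl.
    under [in X in _ = _ + X]eq_bigr do rewrite mulrBl.
    rewrite big_split/= sumrB.
    set A := \sum_(l < n) c l * _; set B := \sum_(l < n) e l * _.
    rewrite (_ : A + B + (t + r) = (A + t) + (B + r)); last by ring.
    rewrite (_ : A - B + (t - r) = (A + t) - (B + r)); last by ring.
    by rewrite (cosD (A + t)) (cosB (A + t)); field.
  rewrite (_ : (fun _ => _) = (fun y =>
    a * cos (\sum_(l < n) c l * y l + t) * G1 y +
    a * cos (\sum_(l < n) c l * y l + t) * G2 y)); last first.
    by apply/funext => y; rewrite mulrDr.
  exact: trig_add.
rewrite (_ : (fun _ => _) = (fun y => F1 y * G y + F2 y * G y)); last first.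
  by apply/funext => y; rewrite mulrDl.
by apply: trig_add; [exact: IH1|exact: IH2].
Qed.

Lemma trig_cst n (a : R) : @trig_poly n (fun=> a).
Proof.
rewrite (_ : (fun=> a) = (fun y =>
  a * cos (\sum_(l < n) (fun=> 0) l * y l + 0))); first exact: trig_cos.
by apply/funext => y; rewrite big1 ?addr0 ?cos0 ?mulr1// => l _; rewrite mul0r.
Qed.

Lemma trig_exp n (F : ('I_n -> R) -> R) k :
  trig_poly F -> trig_poly (fun y => F y ^+ k).
Proof.
move=> tF; elim: k => [|k IH]; first exact: trig_cst.
rewrite (_ : (fun _ => _) = (fun y => F y * F y ^+ k)); first exact: trig_mul.
by apply/funext => y; rewrite exprS.
Qed.

Lemma trig_oneB n (F : ('I_n -> R) -> R) :
  trig_poly F -> trig_poly (fun y => 1 - F y).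
Proof.
move=> tF; rewrite (_ : (fun _ => _) = (fun y => 1 + (-1) * F y)).
  by apply: trig_add; [exact: trig_cst|apply: trig_mul => //; exact: trig_cst].
by apply/funext => y; rewrite mulN1r.
Qed.

Lemma trig_prod n (I : Type) (s : seq I) (F : I -> ('I_n -> R) -> R) :
  (forall i, trig_poly (F i)) -> trig_poly (fun y => \prod_(i <- s) F i y).
Proof.
move=> tF; elim: s => [|i s IH].
  rewrite (_ : (fun _ => _) = (fun=> 1)); first exact: trig_cst.
  by apply/funext => y; rewrite big_nil.
rewrite (_ : (fun _ => _) = (fun y => F i y * \prod_(i <- s) F i y)).
  exact: trig_mul.
by apply/funext => y; rewrite big_cons.
Qed.

(** The sine is rescaled to [[0, 1]] so that the threshold [1 / 2] of [soft_step] is its change of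
    sign. *)
Definition wave n (lam : R) (c : 'I_n -> R) (l : 'I_n) (y : 'I_n -> R) : R :=
  (1 + sin (lam * (c l - y l))) / 2.

Lemma wave_bounds n lam c l (y : 'I_n -> R) : 0 <= wave lam c l y <= 1.
Proof.
have := sin_le1 (lam * (c l - y l)); have := sin_geN1 (lam * (c l - y l)).
by rewrite /wave; lra.
Qed.

Lemma trig_wave n lam (c : 'I_n -> R) l : trig_poly (wave lam c l).
Proof.
rewrite (_ : wave lam c l = (fun y => 2^-1 +
  2^-1 * cos (\sum_(i < n) (if i == l then lam else 0) * y i +
    (pi / 2 - lam * c l)))).
  by apply: trig_add; [exact: trig_cst|exact: trig_cos].
apply/funext => y; rewrite (bigD1 l)//= eqxx big1 => [|i /negbTE ->]; last first.
  by rewrite mul0r.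
rewrite addr0 (_ : lam * y l + _ = pi / 2 - lam * (c l - y l)); last by ring.
rewrite cosB cos_pihalf sin_pihalf mul0r add0r mul1r /wave.
by rewrite mulrDl mul1r mulrC.
Qed.

Lemma sin_small_sgn (x : R) : `|x| < pi -> (0 <= sin x) = (0 <= x).
Proof.
move=> /ltr_normlP[Nx px]; have [x0|x0] := leP 0 x.
  have [->|xn0] := eqVneq x 0; first by rewrite sin0 lexx.
  by apply/ltW/sin_gt0_pi; rewrite px andbT lt_neqAle eq_sym xn0.
apply/negbTE; rewrite -ltNge -oppr_gt0 -sinN.
by apply: sin_gt0_pi; rewrite oppr_gt0 x0.
Qed.

Section TwoFamilies.
Context (d d' : measure_display) (Om : measurableType d) (Om' : measurableType d').
Variables (P : probability Om R) (P' : probability Om' R) (n : nat).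
Variables (Y : 'I_n -> Om -> R) (Y' : 'I_n -> Om' -> R).
Hypotheses (mY : forall l, measurable_fun setT (Y l)).
Hypotheses (mY' : forall l, measurable_fun setT (Y' l)).
Hypothesis YY' : forall (c : 'I_n -> R) (f : R -> R), continuous f ->
  (\int[P]_w (f (\sum_(l < n) c l * Y l w)%R)%:E =
   \int[P']_w (f (\sum_(l < n) c l * Y' l w)%R)%:E)%E.

(** Measurability and a bound are carried along so that sums stay integrable and limits stay
    measurable. *)
Definition same_mean (F : ('I_n -> R) -> R) : Prop :=
  [/\ measurable_fun setT (fun w => F (Y ^~ w)),
      measurable_fun setT (fun w => F (Y' ^~ w)),
      exists C, forall y, `|F y| <= C &
      (\int[P]_w (F (Y ^~ w))%:E = \int[P']_w (F (Y' ^~ w))%:E)%E].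

Lemma bounded_prob_integrable (e : measure_display) (T : measurableType e)
    (Q : probability T R) (f : T -> R) C :
  measurable_fun setT f -> (forall w, `|f w| <= C) ->
  Q.-integrable setT (EFin \o f).
Proof.
move=> mf fC; apply: measurable_bounded_integrable => //.
  by rewrite (le_lt_trans (probability_le1 Q _))// ltry.
exists C; split; first exact: num_real.
by move=> x Cx w _ /=; apply: (le_trans (fC w)); exact: ltW.
Qed.

Lemma same_mean_trig F : trig_poly F -> same_mean F.
Proof.
elim=> [a c t|F1 F2 _ [m1 m1' [C1 b1] e1] _ [m2 m2' [C2 b2] e2]].
  have cf : continuous (fun x => a * cos (x + t)).
    move=> x; apply: cvgM; first exact: cvg_cst.
    apply: (cvg_comp (fun x => x + t) cos); last exact: continuous_cos.
    by apply: cvgD; [exact: cvg_id|exact: cvg_cst].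
  have mf : measurable_fun [set: R] (fun x => a * cos (x + t)).
    exact: continuous_measurable_fun.
  split.
  - apply: (measurableT_comp mf); apply: measurable_sum => l.
    exact: measurable_funM.
  - apply: (measurableT_comp mf); apply: measurable_sum => l.
    exact: measurable_funM.
  - exists `|a| => y; rewrite normrM ler_piMr//; exact: cos_max.
  - exact: (YY' c cf).
split.
- exact: measurable_funD.
- exact: measurable_funD.
- exists (C1 + C2) => y; rewrite (le_trans (ler_normD _ _))// lerD//.
- rewrite !integralD_EFin//; first by rewrite e1 e2.
  all: by apply: bounded_prob_integrable.
Qed.

Lemma same_mean_lim (F : nat -> ('I_n -> R) -> R) G C :
  (forall k, same_mean (F k)) -> (forall k y, `|F k y| <= C) ->
  (forall y, F k y @[k --> \oo] --> G y) -> same_mean G.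
Proof.
move=> sF FC FG.
have mG (e : measure_display) (T : measurableType e) (Z : 'I_n -> T -> R) :
    (forall k, measurable_fun setT (fun w => F k (Z ^~ w))) ->
    measurable_fun setT (fun w => G (Z ^~ w)).
  move=> mF; apply: (measurable_fun_cvg mF) => w _; exact: FG.
have m1 : measurable_fun setT (fun w => G (Y ^~ w)).
  by apply: mG => k; have [] := sF k.
have m2 : measurable_fun setT (fun w => G (Y' ^~ w)).
  by apply: mG => k; have [] := sF k.
have lim (e : measure_display) (T : measurableType e) (Q : probability T R)
    (Z : 'I_n -> T -> R) : (forall k, measurable_fun setT (fun w => F k (Z ^~ w))) ->
    (\int[Q]_w (F k (Z ^~ w))%:E @[k --> \oo] --> \int[Q]_w (G (Z ^~ w))%:E)%E.
  move=> mF.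
  have [] := @dominated_convergence _ T R Q setT measurableT
    (fun k w => (F k (Z ^~ w))%:E) (fun w => (G (Z ^~ w))%:E) (cst C%:E) => //.
  - by move=> k; apply/measurable_EFinP.
  - by apply/measurable_EFinP; exact: mG.
  - by apply: aeW => w _; apply: cvg_EFin; [exact: nearW|exact: FG].
  - exact: finite_measure_integrable_cst.
  - by apply: aeW => w k _; rewrite lee_fin.
split => //.
- exists C => y; have /cvg_lim <- // : `|F k y| @[k --> \oo] --> `|G y|.
    by apply: cvg_norm; exact: FG.
  apply: limr_le; last exact: nearW.
  by apply/cvg_ex; exists `|G y|; apply: cvg_norm; exact: FG.
have mFY k : measurable_fun setT (fun w => F k (Y ^~ w)) by have [] := sF k.
have mFY' k : measurable_fun setT (fun w => F k (Y' ^~ w)) by have [] := sF k.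
have l1 := lim _ _ P Y mFY.
have l2 := lim _ _ P' Y' mFY'.
have e : (fun k => \int[P]_w (F k (Y ^~ w))%:E)%E =
         (fun k => \int[P']_w (F k (Y' ^~ w))%:E)%E.
  by apply/funext => k; have [] := sF k.
by move: l2; rewrite -e => l2; exact: (cvg_unique _ l1 l2).
Qed.

(** Two limits are taken. At a fixed frequency [lam] the steps of the waves converge to the
    indicator of the points where all sines are nonnegative, a periodic set containing unwanted
    copies; letting [lam] tend to [0] pushes these copies to infinity and leaves the orthant. *)
Lemma cramer_wold (b : 'I_n -> R) :
  P [set w | forall l, Y l w <= b l] = P' [set w | forall l, Y' l w <= b l].
Proof.
have prod01 (F : 'I_n -> R) : (forall l, 0 <= F l <= 1) -> `|\prod_l F l| <= 1.
  move=> F01; rewrite normr_prod.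
  elim: (index_enum _) => [|i s IH]; first by rewrite big_nil.
  rewrite big_cons mulr_ile1// ?prodr_ge0//.
  by have /andP[F0 F1] := F01 i; rewrite ger0_norm.
have cvg_prodI (F : nat -> 'I_n -> R) (G : 'I_n -> R) :
    (forall l, F k l @[k --> \oo] --> G l) ->
    \prod_(l < n) F k l @[k --> \oo] --> \prod_(l < n) G l.
  move=> FG; elim: (index_enum _) => [|i s IH].
    rewrite big_nil; under eq_fun do rewrite big_nil.
    exact: cvg_cst.
  rewrite big_cons; under eq_fun do rewrite big_cons.
  by apply: cvgM; [exact: FG|exact: IH].
have s1 lam : same_mean (fun y => \prod_(l < n) (0 <= sin (lam * (b l - y l)))%R%:R).
  apply: (@same_mean_lim
    (fun k y => \prod_(l < n) soft_step k (wave lam b l y)) _ 1).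
  - move=> k; apply: same_mean_trig; apply: trig_prod => l.
    by apply: trig_oneB; apply: trig_exp; apply: trig_oneB; apply: trig_exp;
      exact: trig_wave.
  - by move=> k y; apply: prod01 => l; apply: soft_step_bounds; exact: wave_bounds.
  - move=> y; apply: cvg_prodI => l.
    have -> : (0 <= sin (lam * (b l - y l)))%R = (1 / 2 <= wave lam b l y).
      by rewrite /wave ler_pM2r ?invr_gt0// lerDl.
    by apply: soft_step_cvg; exact: wave_bounds.
have s2 : same_mean (fun y => \prod_(l < n) (y l <= b l)%R%:R).
  apply: (@same_mean_lim (fun k y =>
    \prod_(l < n) (0 <= sin (harmonic k * (b l - y l)))%R%:R) _ 1) => //.
  - by move=> k y; apply: prod01 => l; rewrite ler0n lern1 leq_b1.
  - move=> y; apply: cvg_prodI => l; apply: cvg_near_cst.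
    have hl : harmonic k * (b l - y l) @[k --> \oo] --> 0.
      rewrite -[X in _ --> X](mul0r (b l - y l)); apply: cvgM; last exact: cvg_cst.
      exact: cvg_harmonic.
    (* Inside []-pi, pi[] the sine has the sign of its argument, so each factor is eventually
       constant in [k]. *)
    have hn : \forall k \near \oo, `|harmonic k * (b l - y l)| < pi.
      by apply: (cvgr0_norm_lt _ hl); exact: pi_gt0.
    apply: filterS hn => k hk; rewrite sin_small_sgn//.
    by rewrite pmulr_rge0 ?subr_ge0// /harmonic/= invr_gt0.
have ind (T : Type) (Z : 'I_n -> T -> R) w :
    \prod_(l < n) (Z l w <= b l)%R%:R = \1_[set w | forall l, Z l w <= b l] w :> R.
  rewrite indicE; have [h|/existsNP[l hl]] := pselect (forall l, Z l w <= b l).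
    by rewrite mem_set// big1// => l _; rewrite h.
  rewrite memNset/=; last by move=> /(_ l).
  by rewrite (bigD1 l)//= (negbTE (introN idP hl)) mul0r.
have mind (e : measure_display) (T : measurableType e) (Z : 'I_n -> T -> R) :
    (forall l, measurable_fun setT (Z l)) ->
    measurable [set w | forall l, Z l w <= b l].
  move=> mZ; rewrite (_ : [set w | _] =
      \bigcap_(l in [set: 'I_n]) (Z l @^-1` `]-oo, b l]%classic)).
    apply: fin_bigcap_measurable; first exact: finite_finset.
    by move=> l _; rewrite -[X in measurable X]setTI; apply: mZ.
  apply/seteqP; split => w /= h l; first by move=> _ /=; rewrite in_itv/= h.
  by have := h l I; rewrite /= in_itv.
have [_ _ _] := s2.
under eq_integral do rewrite ind.
under [in X in _ = X]eq_integral do rewrite ind.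
by rewrite !integral_indic ?setIT//; exact: mind.
Qed.

End TwoFamilies.
End CramerWold.

(** * Events up to null sets *)

Section Completion.
Context (R : realType) (d : measure_display) (Om : measurableType d).
Variable P : probability Om R.

(** The outer measure does not see the measurable null cover [M] of [N], so both the Caratheodory
    condition and the value pass from [B] to [A]. *)
Lemma completion_ae_eq (A B N : set Om) :
  measurable B -> P.-negligible N -> (forall w, ~ N w -> A w <-> B w) ->
  completion_measurable P A /\ completion_prob P A = P B.
Proof.
move=> mB [M [mM M0 NM]] AB.
have PM : (P^* M)%mu = 0%E by rewrite measurable_mu_extE.
have AB' w : ~ M w -> A w <-> B w by move=> Mw; apply: AB => /NM.
have ltM (X Y : set Om) : X `<=` Y `|` M -> ((P^* X)%mu <= (P^* Y)%mu)%E.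
  move=> XYM; apply: (le_trans (le_outer_measure (P^*)%mu _ _ XYM)).
  by rewrite (le_trans (outer_measureU2 (P^*)%mu Y M))//= PM adde0.
split.
  apply: le_caratheodory_measurable => X.
  have cB : ((P^*)%mu).-caratheodory B by exact: caratheodory_measurable_mu_ext.
  apply: (@le_trans _ _ ((P^* (X `&` B))%mu + (P^* (X `&` ~` B))%mu)%E); last first.
    by rewrite le_eqVlt; apply/orP; left; apply/eqP/esym; exact: (cB X).
  apply: leeD; apply: ltM => w [Xw].
    by move=> Aw; have [|Mw] := pselect (M w); [right|left; split => //; apply/AB'].
  move=> nAw; have [|Mw] := pselect (M w); [by right|left; split => //].
  by move=> /AB' => /(_ Mw).
rewrite /completion_prob /completed_measure_extension -measurable_mu_extE//.
apply/eqP; rewrite eq_le; apply/andP; split; apply: ltM => w.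
  by move=> Aw; have [|Mw] := pselect (M w); [right|left; apply/AB'].
by move=> Bw; have [|Mw] := pselect (M w); [right|left; apply/AB'].
Qed.

End Completion.

(** * Countable constraints and negative suprema *)

Section CountableEvents.
Variable R : realType.
Context (d d' : measure_display) (Om : measurableType d) (Om' : measurableType d').
Variables (P : probability Om R) (P' : probability Om' R).

Lemma measurable_all_le (e : measure_display) (T : measurableType e)
    (Z : nat -> T -> R) (b : nat -> R) (D : set nat) :
  (forall r, measurable_fun setT (Z r)) ->
  measurable [set w | forall r, D r -> Z r w <= b r].
Proof.
move=> mZ; rewrite (_ : [set w | _] =
    \bigcap_(r in D) (Z r @^-1` `]-oo, b r]%classic)).
  apply: bigcap_measurableType => // r _.
  by rewrite -[X in measurable X]setTI; apply: mZ.
by apply/seteqP; split => w /= h l Dl; have := h l Dl; rewrite /= in_itv.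
Qed.

Lemma cramer_wold_countable (Y : nat -> Om -> R) (Y' : nat -> Om' -> R)
    (b : nat -> R) :
  (forall l, measurable_fun setT (Y l)) ->
  (forall l, measurable_fun setT (Y' l)) ->
  (forall n (c : 'I_n -> R) (f : R -> R), continuous f ->
    (\int[P]_w (f (\sum_(l < n) c l * Y l w)%R)%:E =
     \int[P']_w (f (\sum_(l < n) c l * Y' l w)%R)%:E)%E) ->
  P [set w | forall r, Y r w <= b r] = P' [set w | forall r, Y' r w <= b r].
Proof.
move=> mY mY' YY'.
have lim (e : measure_display) (T : measurableType e) (Q : probability T R)
    (Z : nat -> T -> R) : (forall r, measurable_fun setT (Z r)) ->
    Q [set w | forall l : 'I_n, Z l w <= b l] @[n --> \oo] -->
      Q [set w | forall r, Z r w <= b r].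
  move=> mZ.
  have eqn n : [set w | forall l : 'I_n, Z l w <= b l] =
               [set w | forall r, [set r | (r < n)%N] r -> Z r w <= b r].
    apply/seteqP; split => w /= h; first by move=> r rn; exact: (h (Ordinal rn)).
    by move=> l; apply: h => /=.
  rewrite (_ : [set w | forall r, _] =
      \bigcap_n [set w | forall l : 'I_n, Z l w <= b l]).
    apply: nonincreasing_cvg_mu => //.
    - by rewrite (le_lt_trans (probability_le1 Q _))// ?ltry// eqn; exact: measurable_all_le.
    - by move=> n; rewrite eqn; exact: measurable_all_le.
    - apply: bigcap_measurableType => // n _; rewrite eqn; exact: measurable_all_le.
    - move=> n k nk; apply/subsetPset => w /= h l.
      exact: (h (widen_ord nk l)).
  apply/seteqP; split => w /= h; first by move=> n _ l.
  by move=> r; exact: (h r.+1 I (Ordinal (ltnSn r))).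
have l1 := lim _ _ P Y mY; have l2 := lim _ _ P' Y' mY'.
have e : (fun n => P [set w | forall l : 'I_n, Y l w <= b l]) =
         (fun n => P' [set w | forall l : 'I_n, Y' l w <= b l]).
  by apply/funext => n; apply: cramer_wold => // c f cf; exact: YY'.
by move: l2; rewrite -e => l2; exact: (cvg_unique _ l1 l2).
Qed.

Lemma nondecreasing_mu_eq (B : (set Om)^nat) (B' : (set Om')^nat) :
  (forall n, measurable (B n)) -> (forall n, measurable (B' n)) ->
  nondecreasing_seq B -> nondecreasing_seq B' ->
  (forall n, P (B n) = P' (B' n)) -> P (\bigcup_n B n) = P' (\bigcup_n B' n).
Proof.
move=> mB mB' ndB ndB' BB'.
have l1 := nondecreasing_cvg_mu mB (bigcupT_measurable _ mB) ndB : P \o B @ \oo --> P _.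
have l2 := nondecreasing_cvg_mu mB' (bigcupT_measurable _ mB') ndB' : P' \o B' @ \oo --> P' _.
have e : P \o B = P' \o B' by apply/funext.
by move: l2; rewrite -e => l2; exact: (cvg_unique _ l1 l2).
Qed.

End CountableEvents.

(** A negative real supremum leaves room for some [1 / (n + 1)]. The value [-oo] occurs only for
    empty [D], where any [n] will do. *)
Lemma sup_lt0P (R : realType) (Om : Type) m (D : set 'rV[R]_m)
    (X : 'rV[R]_m -> Om -> R) (h : 'rV[R]_m -> R) w :
  sup_lt0 D X h w <->
  exists n, forall t, D t -> X t w - h t <= - n.+1%:R^-1.
Proof.
split => [|[n H]]; last first.
  rewrite /sup_lt0 /=.
  apply: (@le_lt_trans _ _ (- n.+1%:R^-1 : R)%:E).
    by apply: ge_ereal_sup => _ [t Dt <-]; rewrite lee_fin H.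
  by rewrite lte_fin oppr_lt0 invr_gt0.
rewrite /sup_lt0 /=; set s := ereal_sup _ => s0.
have ub t : D t -> ((X t w - h t)%:E <= s)%E.
  by move=> Dt; apply: ereal_sup_ubound; exists t.
case: s s0 ub => [r|//|_ ub]; last first.
  by exists 0%N => t /ub; rewrite leeNy_eq.
rewrite lte_fin => r0 ub.
exists (Num.truncn (- r)^-1) => t /ub; rewrite lee_fin => /le_trans; apply.
rewrite lerNr -[leRHS]invrK lef_pV2 ?posrE ?invr_gt0 ?oppr_gt0// ?ltr0n//.
by apply/ltW/truncnS_gt.
Qed.

Section SupEvents.
Variable R : realType.
Context (d d' : measure_display) (Om : measurableType d) (Om' : measurableType d').
Variables (P : probability Om R) (P' : probability Om' R) (m : nat).
Variables (D D0 : set 'rV[R]_m) (q : nat -> 'rV[R]_m) (G : 'rV[R]_m -> R).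
Hypothesis qD : forall r, D (q r).

(* On [D `\` D0] the fields vanish, so that the constraint there is the
   deterministic condition below; on [D0] it is enforced along [q]. *)
Let boundary_ok n : Prop :=
  forall s, D s -> ~ D0 s -> - G s <= - n.+1%:R^-1.

Let approx (T : Type) (W : 'rV[R]_m -> T -> R) n : set T :=
  [set w | boundary_ok n /\ forall r, W (q r) w <= G (q r) - n.+1%:R^-1].

Let invS_le n k : (n <= k)%N -> - n.+1%:R^-1 <= - k.+1%:R^-1 :> R.
Proof. by move=> nk; rewrite lerN2 lef_pV2 ?posrE ?ltr0n// ler_nat. Qed.

Let measurable_approx (e : measure_display) (T : measurableType e)
    (W : 'rV[R]_m -> T -> R) n :
  (forall r, measurable_fun setT (W (q r))) -> measurable (approx W n).
Proof.
move=> mW; have [ok|nok] := pselect (boundary_ok n); last first.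
  rewrite (_ : approx W n = set0)//.
  by apply/seteqP; split => // w [].
rewrite (_ : approx W n =
    [set w | forall r, [set: nat] r -> W (q r) w <= G (q r) - n.+1%:R^-1]).
  by apply: (@measurable_all_le _ _ _ (fun r => W (q r))).
by apply/seteqP; split => [w [_ h] r _|w /= h]; [exact: h|split => // r; exact: h].
Qed.

Let nondecreasing_approx (T : Type) (W : 'rV[R]_m -> T -> R) :
  nondecreasing_seq (approx W).
Proof.
move=> n k nk; apply/subsetPset => w [ok h]; split => [s Ds D0s|r].
  by rewrite (le_trans (ok s Ds D0s))// invS_le.
by rewrite (le_trans (h r))// lerD2l invS_le.
Qed.

(** The events [approx] are measurable because they consult the field only at the points [q r]. Off
    [N], the density hypothesis extends their bounds to all of [D0]; it is stated for every bound
    [c] so that the margin survives. *)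
Lemma sup_lt0_completion (e : measure_display) (T : measurableType e)
    (Q : probability T R) (W : 'rV[R]_m -> T -> R) (A N : set T) :
  (forall r, measurable_fun setT (W (q r))) ->
  (forall s w, D s -> ~ D0 s -> W s w = 0) ->
  Q.-negligible N ->
  (forall w, ~ N w -> forall s c, D0 s ->
    (forall r, W (q r) w - G (q r) <= c) -> W s w - G s <= c) ->
  (forall w, A w <-> exists n, forall s, D s -> W s w - G s <= - n.+1%:R^-1) ->
  completion_measurable Q A /\
  completion_prob Q A = Q (\bigcup_n approx W n).
Proof.
move=> mW W0 N0 dense AE; apply: (completion_ae_eq _ N0).
  by apply: bigcupT_measurable => n; exact: measurable_approx.
move=> w Nw; apply: (iff_trans (AE w)); split=> [[n H]|[n _ [ok h]]].
  exists n => //; split => [s Ds D0s|r]; last by rewrite -lerBlDl H.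
  by have := H s Ds; rewrite W0// sub0r.
exists n => s Ds; have [D0s|D0s] := pselect (D0 s).
  by apply: (dense w Nw) => // r; rewrite lerBlDl h.
by rewrite W0// sub0r ok.
Qed.

(** [boundary_ok] involves [G] alone, so it holds or fails for both fields at once; what remains is
    a countable family of constraints. *)
Lemma sup_lt0_completion_eq (W : 'rV[R]_m -> Om -> R) (W' : 'rV[R]_m -> Om' -> R) :
  (forall r, measurable_fun setT (W (q r))) ->
  (forall r, measurable_fun setT (W' (q r))) ->
  (forall n (c : 'I_n -> R) (f : R -> R), continuous f ->
    (\int[P]_w (f (\sum_(l < n) c l * W (q l) w)%R)%:E =
     \int[P']_w (f (\sum_(l < n) c l * W' (q l) w)%R)%:E)%E) ->
  P (\bigcup_n approx W n) = P' (\bigcup_n approx W' n).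
Proof.
move=> mW mW' WW'; apply: nondecreasing_mu_eq => //.
- by move=> n; exact: measurable_approx.
- by move=> n; exact: measurable_approx.
move=> n; have [ok|nok] := pselect (boundary_ok n); last first.
  have e0 (T : Type) (V : 'rV[R]_m -> T -> R) : approx V n = set0.
    by apply/seteqP; split => // w [].
  by rewrite !e0 !measure0.
have e1 (T : Type) (V : 'rV[R]_m -> T -> R) :
    approx V n = [set w | forall r, V (q r) w <= G (q r) - n.+1%:R^-1].
  by apply/seteqP; split => [w [_ h]|w h].
rewrite !e1; apply: (@cramer_wold_countable _ _ _ _ _ _ _
  (fun r => W (q r)) (fun r => W' (q r))) => //.
Qed.

End SupEvents.

(** * Linear combinations of a Brownian sheet *)

Section SheetCombinations.
Context (R : realType) (d : measure_display) (Om : measurableType d).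
Variables (P : probability Om R) (m : nat) (T : 'I_m -> set R).
Variable X : 'rV[R]_m -> Om -> R.
Hypothesis hX : brownian_sheet P T X.

Definition sheet_cov (s t : 'rV[R]_m) : R :=
  \prod_(i < m) Num.min (s ord0 i) (t ord0 i).

Lemma sheet_measurable t : box T t -> measurable_fun setT (X t).
Proof. by move=> Tt; apply: (bs_gaussian hX).1. Qed.

Lemma sheet_L2 t : box T t -> P.-integrable setT (fun w => (X t w ^+ 2)%:E).
Proof.
move=> Tt; apply: gaussian_law_L2; first exact: sheet_measurable.
have := (bs_gaussian hX).2 1 (fun=> t) (fun=> 1) (fun=> Tt).
rewrite (_ : (fun w => \sum_(l < 1) 1 * X t w) = X t)//.
by apply/funext => w; rewrite big_ord1 mul1r.
Qed.

Lemma sheet_integrable t : box T t -> P.-integrable setT (fun w => (X t w)%:E).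
Proof.
move=> Tt; apply: (@le_integrable _ _ _ P setT measurableT _
    (fun w => (1%:E + (X t w ^+ 2)%:E)%E)).
- by apply/measurable_EFinP; exact: sheet_measurable.
- move=> w _; rewrite -EFinD !abse_EFin lee_fin.
  rewrite [leRHS]ger0_norm ?addr_ge0 ?sqr_ge0// -(real_normK (num_real (X t w))).
  by have := normr_ge0 (X t w); nra.
- apply: integrableD => //; first exact: finite_measure_integrable_cst.
  exact: sheet_L2.
Qed.

Lemma sheet_prod_integrable s t : box T s -> box T t ->
  P.-integrable setT (fun w => (X s w * X t w)%:E).
Proof.
move=> Ts Tt; apply: (@le_integrable _ _ _ P setT measurableT _
    (fun w => ((X s w ^+ 2)%:E + (X t w ^+ 2)%:E)%E)).
- by apply/measurable_EFinP; apply: measurable_funM; exact: sheet_measurable.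
- move=> w _; rewrite -EFinD !abse_EFin lee_fin.
  rewrite [leRHS]ger0_norm ?addr_ge0 ?sqr_ge0//.
  by rewrite ler_norml; nra.
- by apply: integrableD => //; exact: sheet_L2.
Qed.

Section Combination.
Variables (k : nat) (t : 'I_k -> 'rV[R]_m) (c : 'I_k -> R).
Hypothesis Tt : forall l, box T (t l).

Let U w := \sum_(l < k) c l * X (t l) w.

Lemma sheet_combo_measurable : measurable_fun setT U.
Proof.
apply: measurable_sum => l; apply: measurable_funM => //.
exact: sheet_measurable.
Qed.

Lemma sheet_combo_gaussian : gaussian_law (pushforward P U).
Proof. exact: (bs_gaussian hX).2. Qed.

Lemma sheet_combo_mean : (\int[P]_w (U w)%:E = 0)%E.
Proof.
have iE l : P.-integrable setT (fun w => (c l)%:E * (X (t l) w)%:E)%E.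
  by apply: integrableZl => //; exact: sheet_integrable.
transitivity (\int[P]_w (\sum_(l < k) (c l)%:E * (X (t l) w)%:E))%E.
  by apply: eq_integral => w _; rewrite sumEFin.
rewrite integral_sum// big1// => l _; rewrite integralZl//; last exact: sheet_integrable.
by have := bs_mean hX (Tt l); rewrite unlock => ->; rewrite mule0.
Qed.

Lemma sheet_combo_var : (\int[P]_w (U w ^+ 2)%:E =
  (\sum_(l < k) \sum_(r < k) c l * c r * sheet_cov (t l) (t r))%:E)%E.
Proof.
pose F (p : 'I_k * 'I_k) w :=
  ((c p.1 * c p.2)%:E * (X (t p.1) w * X (t p.2) w)%:E)%E.
have iF p : P.-integrable setT (F p).
  by apply: integrableZl => //; exact: sheet_prod_integrable.
transitivity (\int[P]_w (\sum_(p : 'I_k * 'I_k) F p w))%E.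
  apply: eq_integral => w _; rewrite /F.
  under eq_bigr do rewrite -EFinM.
  rewrite sumEFin -(pair_big xpredT xpredT (fun i j => c i * c j * (X (t i) w * X (t j) w))).
  rewrite expr2 mulr_suml; congr (_%:E); apply: eq_bigr => i _.
  by rewrite mulr_sumr; apply: eq_bigr => j _; ring.
rewrite integral_sum// pair_big/= -sumEFin; apply: eq_bigr => p _.
rewrite /F integralZl//; last exact: sheet_prod_integrable.
by have := bs_cov hX (Tt p.1) (Tt p.2); rewrite unlock EFinM => ->.
Qed.

End Combination.
End SheetCombinations.

(** A combination of rescaled values is again a combination of sheet values, hence centered
    Gaussian, and the covariance identity makes the two variances equal. The scalars [e] and [e']
    are there to absorb the weight. *)
Lemma sheet_same_law (R : realType) (d d' : measure_display)
    (Om : measurableType d) (Om' : measurableType d')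
    (P : probability Om R) (P' : probability Om' R) (m m' : nat)
    (T : 'I_m -> set R) (T' : 'I_m' -> set R)
    (X : 'rV[R]_m -> Om -> R) (X' : 'rV[R]_m' -> Om' -> R)
    (t : nat -> 'rV[R]_m) (t' : nat -> 'rV[R]_m') (e e' : nat -> R) :
  brownian_sheet P T X -> brownian_sheet P' T' X' ->
  (forall r, box T (t r)) -> (forall r, box T' (t' r)) ->
  (forall r l, e r * e l * sheet_cov (t r) (t l) =
               e' r * e' l * sheet_cov (t' r) (t' l)) ->
  forall n (c : 'I_n -> R) (f : R -> R), continuous f ->
    (\int[P]_w (f (\sum_(l < n) c l * (e l * X (t l) w))%R)%:E =
     \int[P']_w (f (\sum_(l < n) c l * (e' l * X' (t' l) w))%R)%:E)%E.
Proof.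
move=> hX hX' Tt Tt' H n c f cf.
pose U w := \sum_(l < n) (c l * e l) * X (t l) w.
pose U' w := \sum_(l < n) (c l * e' l) * X' (t' l) w.
transitivity (\int[P]_w (f (U w))%:E)%E.
  apply: eq_integral => w _; congr (f _)%:E.
  by apply: eq_bigr => l _; rewrite mulrA.
transitivity (\int[P']_w (f (U' w))%:E)%E; last first.
  apply: eq_integral => w _; congr (f _)%:E.
  by apply: eq_bigr => l _; rewrite mulrA.
apply: centered_gaussian_law_eq => //.
- exact: (sheet_combo_measurable hX).
- exact: (sheet_combo_gaussian hX).
- exact: (sheet_combo_measurable hX').
- exact: (sheet_combo_gaussian hX').
- exact: (sheet_combo_mean hX).
- exact: (sheet_combo_mean hX').
rewrite (sheet_combo_var hX)// (sheet_combo_var hX')//; congr (_%:E).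
apply: eq_bigr => l _; apply: eq_bigr => r _.
rewrite (_ : _ * _ * _ = c l * c r * (e l * e r * sheet_cov (t l) (t r))); last by ring.
by rewrite H; ring.
Qed.

(** * Path continuity of the Brownian sheet *)

Section ProductIncrements.
Variable R : realType.

(** Factors are exchanged one at a time, each exchange costing [e] times a bound on the other
    factors; [1 <= L] allows that bound to be rounded up to [L ^+ m]. *)
Lemma prod_increment (m : nat) (a b : 'I_m -> R) (L e : R) : 1 <= L -> 0 <= e ->
  (forall i, 0 <= b i) -> (forall i, b i <= a i) -> (forall i, a i <= L) ->
  (forall i, a i - b i <= e) ->
  \prod_i a i - \prod_i b i <= m%:R * L ^+ m * e.
Proof.
move=> L1 e0 b0 ba aL abe.
suff H (s : seq 'I_m) : [/\ 0 <= \prod_(i <- s) b i,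
    \prod_(i <- s) b i <= \prod_(i <- s) a i,
    \prod_(i <- s) a i <= L ^+ size s &
    \prod_(i <- s) a i - \prod_(i <- s) b i <= (size s)%:R * L ^+ size s * e].
  have [_ _ _] := H (index_enum 'I_m).
  by rewrite [X in _ <= X%:R * _ ^+ X * _](_ : _ = m)// -[RHS]card_ord cardT enumT.
elim: s => [|i s [pb0 pba paL pd]].
  by rewrite !big_nil subrr mul0r mul0r; split => //; rewrite expr0.
rewrite !big_cons /= exprS -natr1.
set A := \prod_(j <- s) a j in pba paL pd *; set B := \prod_(j <- s) b j in pb0 pba pd *.
set k := (size s)%:R in pd *; set M := L ^+ size s in paL pd *.
have ha := aL i; have hb := b0 i; have hba := ba i; have hd := abe i.
have k0 : 0 <= k by exact: ler0n.
have A0 : 0 <= A by exact: le_trans pb0 pba.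
have M0 : 0 <= M by exact: le_trans A0 paL.
have a0 : 0 <= a i by exact: le_trans hb hba.
split.
- exact: mulr_ge0.
- exact: ler_pM.
- exact: ler_pM.
have -> : a i * A - b i * B = (a i - b i) * A + b i * (A - B) by ring.
have h1 : (a i - b i) * A <= e * (L * M).
  apply: ler_pM => //; first by rewrite subr_ge0.
  by rewrite (le_trans paL)// ler_peMl.
have h2 : b i * (A - B) <= L * (k * M * e).
  by apply: ler_pM => //; [rewrite subr_ge0|exact: le_trans hba ha].
apply: (le_trans (lerD h1 h2)).
by rewrite le_eqVlt; apply/orP; left; apply/eqP; ring.
Qed.

End ProductIncrements.

Section NullSets.
Context (R : realType) (d : measure_display) (Om : measurableType d).
Variable P : probability Om R.

Lemma prob_bigsetU_le (I : Type) (s : seq I) (F : I -> set Om) (c : R) :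
  (forall i, measurable (F i)) -> (forall i, (P (F i) <= c%:E)%E) ->
  (P (\big[setU/set0]_(i <- s) F i) <= ((size s)%:R * c)%:E)%E.
Proof.
move=> mF Fc; elim: s => [|i s IH]; first by rewrite big_nil measure0 mul0r.
rewrite big_cons (le_trans (measureU2 _ _ _))//.
  by apply: bigsetU_measurable.
by rewrite /= -natr1 mulrDl mul1r EFinD addeC leeD.
Qed.

Lemma borel_cantelli_half (F : (set Om)^nat) (K : R) :
  (forall p, measurable (F p)) ->
  (forall p, (P (F p) <= (K / 2 ^+ p)%:E)%E) ->
  P.-negligible (lim_sup_set F).
Proof.
move=> mF FK.
have mL : measurable (lim_sup_set F).
  by apply: bigcap_measurableType => n _; exact: bigcup_measurable.
apply/negligibleP => //; apply: lim_sup_set_cvg0 => //.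
apply: (@le_lt_trans _ _ (\sum_(p <oo) (2 * K / (2 ^ (p + 1))%:R)%:E)%E).
  apply: lee_nneseries => [//|p _].
  apply: (le_trans (FK p)); rewrite lee_fin addn1 expnS natrM natrX.
  rewrite invfM mulrA [2 * K]mulrC mulfK//.
have /cvg_lim -> // := @cvg_geometric_eseries_half R (2 * K) 0.
exact: ltry.
Qed.

Lemma negligible_countable (I : Type) (Q : set I) (F : I -> set Om) :
  countable Q -> (forall i, Q i -> P.-negligible (F i)) ->
  P.-negligible [set w | exists2 i, Q i & F i w].
Proof.
move=> /countable_injP[f finj] QF.
pose G n := [set w | exists i, [/\ Q i, f i = n & F i w]].
apply: (@negligibleS _ _ _ _ (\bigcup_n G n)).
  by move=> w [i Qi Fi]; exists (f i) => //; exists i.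
apply: negligible_bigcup => n.
have [[i [Qi fi]]|h] := pselect (exists i, Q i /\ f i = n).
  apply: negligibleS (QF _ Qi) => w [k [Qk fk Fk]].
  by rewrite (finj i k) ?inE// fi fk.
apply: negligibleS (negligible_set0 _) => w [k [Qk fk _]].
by apply: h; exists k.
Qed.

End NullSets.

(** * Tail bounds for increments of the sheet *)

Section SheetIncrements.
Context (R : realType) (d : measure_display) (Om : measurableType d).
Variables (P : probability Om R) (m : nat) (y : 'I_m -> R).
Let T i : set R := `[0, y i]%classic.
Variable X : 'rV[R]_m -> Om -> R.
Hypothesis hX : brownian_sheet P T X.
Variable L : R.
Hypotheses (L1 : 1 <= L) (yL : forall i, y i <= L).

(** This is one half of the variance computation: the variance of [X s - X t] is this difference
    plus the same one with [s] and [t] exchanged. *)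
Lemma sheet_cov_increment (s t : 'rV[R]_m) (e : R) : 0 <= e -> box T s -> box T t ->
  (forall i, `|s ord0 i - t ord0 i| <= e) ->
  sheet_cov s s - sheet_cov s t <= m%:R * L ^+ m * e.
Proof.
move=> e0 Ts Tt st; rewrite /sheet_cov; apply: prod_increment => // i.
- have := Ts i; have := Tt i; rewrite /T/= !in_itv/= => /andP[t0 _] /andP[s0 _].
  by rewrite le_min s0.
- by rewrite minxx ge_min lexx.
- by have := Ts i; rewrite /T/= in_itv/= minxx => /andP[_ h]; exact: le_trans h (yL i).
- have := st i; rewrite minxx ler_norml => /andP[h1 h2].
  by have [h|h] := leP (s ord0 i) (t ord0 i); lra.
Qed.

(** Markov's inequality for the moment of order [2 * q]. The variance is only linear in [e], but
    Gaussian moments turn it into [e ^+ q] with [q] as large as desired, enough to beat the number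
    of grid points in any dimension. *)
Lemma sheet_increment_tail (q : nat) (s t : 'rV[R]_m) (e u : R) :
  0 <= e -> 0 < u -> box T s -> box T t ->
  (forall i, `|s ord0 i - t ord0 i| <= e) ->
  (P [set w | (u <= `|X s w - X t w|)%R] <=
    (gamma_moment R (2 * q) / gamma_moment R 2 ^+ q *
     (2 * (m%:R * L ^+ m) * e) ^+ q / u ^+ (2 * q))%:E)%E.
Proof.
move=> e0 u0 Ts Tt st.
pose c (l : 'I_2) : R := if l == ord0 then 1 else -1.
pose p (l : 'I_2) := if l == ord0 then s else t.
have Tp l : box T (p l) by rewrite /p; case: ifP.
pose U w := \sum_(l < 2) c l * X (p l) w.
have UE w : U w = X s w - X t w.
  by rewrite /U !big_ord_recl big_ord0 /c /p/= addr0 mul1r mulN1r.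
have mU : measurable_fun setT U by exact: (sheet_combo_measurable hX).
pose v : R := \sum_(l < 2) \sum_(r < 2) c l * c r * sheet_cov (p l) (p r).
have Uv : (\int[P]_w (U w ^+ 2)%:E = v%:E)%E by exact: (sheet_combo_var hX).
have v0 : 0 <= v.
  by rewrite -lee_fin -Uv integral_ge0// => w _; rewrite lee_fin sqr_ge0.
have symc (a b : 'rV[R]_m) : sheet_cov a b = sheet_cov b a.
  by apply: eq_bigr => i _; rewrite minC.
have vE : v = (sheet_cov s s - sheet_cov s t) + (sheet_cov t t - sheet_cov t s).
  rewrite /v !big_ord_recl !big_ord0 /c /p/= (symc t s); ring.
have vb : v <= 2 * (m%:R * L ^+ m) * e.
  rewrite vE; have ts i : `|t ord0 i - s ord0 i| <= e by rewrite distrC.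
  by have := sheet_cov_increment e0 Ts Tt st; have := sheet_cov_increment e0 Tt Ts ts; lra.
have M := centered_gaussian_moment q mU (sheet_combo_gaussian hX c Tp)
  (sheet_combo_mean hX c Tp) Uv.
have uq0 : 0 < u ^+ (2 * q) by rewrite exprn_gt0.
have K0 : 0 <= gamma_moment R (2 * q) / gamma_moment R 2 ^+ q.
  rewrite divr_ge0 ?exprn_ge0 ?(ltW (gamma_moment2_gt0 R))//.
  rewrite -lee_fin -gamma_momentE integral_ge0// => x _.
  by rewrite lee_fin exprM exprn_ge0// sqr_ge0.
have mA : measurable [set w | u <= `|X s w - X t w|].
  rewrite (_ : [set w | _] = (fun w => `|U w|) @^-1` `[u, +oo[%classic).
    by rewrite -[X in measurable X]setTI; apply: (measurableT_comp (@normr_measurable R setT)).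
  by apply/seteqP; split => w /=; rewrite in_itv/= andbT UE.
rewrite EFinM lee_pdivlMr//.
have -> : P [set w | (u <= `|X s w - X t w|)%R] =
    (\int[P]_w (\1_[set w | (u <= `|X s w - X t w|)%R] w)%:E)%E.
  by rewrite integral_indic// setIT.
rewrite muleC -ge0_integralZl//; last 2 first.
- by apply/measurable_EFinP; exact: measurable_indic.
- by rewrite lee_fin ltW.
apply: (@le_trans _ _ (\int[P]_w (U w ^+ (2 * q))%:E)%E); last first.
  by rewrite M lee_fin ler_wpM2l// lerXn2r// nnegrE// (le_trans v0).
apply: ge0_le_integral => //.
- by move=> w _; rewrite -EFinM lee_fin mulr_ge0// ltW.
- by apply: measurable_funeM; apply/measurable_EFinP; exact: measurable_indic.
- by apply/measurable_EFinP; exact: measurable_funX.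
move=> w _; rewrite -EFinM lee_fin indicE.
have [|h] := boolP (w \in _).
  rewrite inE/= -UE => h; rewrite mulr1 exprM (exprM (U w)).
  rewrite -(real_normK (num_real (U w))) -!exprM.
  by rewrite lerXn2r// ?nnegrE// ltW.
by rewrite mulr0 exprM exprn_ge0// sqr_ge0.
Qed.

(* The moment order is chosen so that [4^m (8/9)^q <= 1/2]: here [8/9] is the
   ratio of the variance scale [2^-p] to the squared threshold [(3/4)^(2p)]
   and [4^m] is the growth rate of the number of pairs of grid points. *)
Lemma sheet_dyadic_tail : exists2 K : R, 0 <= K & forall p s t, box T s -> box T t ->
  (forall i, `|s ord0 i - t ord0 i| <= L / 2 ^+ p) ->
  (P [set w | ((3 / 4) ^+ p <= `|X s w - X t w|)%R] <=
    (K / (2 * 4 ^+ m) ^+ p)%:E)%E.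
Proof.
have [q hq] : exists q, 4 ^+ m * (8 / 9) ^+ q <= 1 / 2 :> R.
  have c0 : (4 ^+ m * (8 / 9) ^+ q : R) @[q --> \oo] --> 0.
    rewrite -[X in _ --> X](mulr0 (4 ^+ m)); apply: cvgM; first exact: cvg_cst.
    by apply: cvg_expr; rewrite ger0_norm; lra.
  have hn : \forall q \near \oo, `|4 ^+ m * (8 / 9) ^+ q| <= 1 / 2 :> R.
    by apply: (cvgr0_norm_le _ c0); lra.
  have [q _ /(_ q (leqnn q)) h] := hn.
  by exists q; apply: le_trans h; exact: ler_norm.
pose M := gamma_moment R (2 * q) / gamma_moment R 2 ^+ q.
pose C := (2 * (m%:R * L ^+ m) * L) ^+ q.
have M0 : 0 <= M.
  rewrite divr_ge0 ?exprn_ge0 ?(ltW (gamma_moment2_gt0 R))//.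
  rewrite -lee_fin -gamma_momentE integral_ge0// => x _.
  by rewrite lee_fin exprM exprn_ge0// sqr_ge0.
have L0 : 0 <= L by rewrite (le_trans _ L1).
have C0 : 0 <= C by rewrite exprn_ge0// !mulr_ge0// exprn_ge0.
exists (M * C) => [|p s t Ts Tt st]; first exact: mulr_ge0.
have e0 : 0 <= L / 2 ^+ p by rewrite divr_ge0// exprn_ge0.
have u0 : 0 < (3 / 4) ^+ p :> R by rewrite exprn_gt0//; lra.
apply: (le_trans (sheet_increment_tail q e0 u0 Ts Tt st)).
rewrite lee_fin -/M.
have r2 : 2^-1 / (3 / 4) ^+ 2 = 8 / 9 :> R by field.
have rate : (2 ^+ p)^-1 ^+ q / ((3 / 4) ^+ p) ^+ (2 * q) = ((8 / 9) ^+ q) ^+ p :> R.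
  rewrite -exprVn -(exprM (3 / 4)) mulnCA (exprM (3 / 4)) -(exprM 2^-1).
  by rewrite -[((3 / 4) ^+ 2) ^- _]exprVn -exprMn r2 mulnC exprM.
have -> : (2 * (m%:R * L ^+ m) * (L / 2 ^+ p)) ^+ q = C * (2 ^+ p)^-1 ^+ q.
  by rewrite mulrA exprMn.
rewrite -(mulrA M) -(mulrA C) rate mulrA; apply: ler_wpM2l; first exact: mulr_ge0.
have d0 : 0 < 2 * 4 ^+ m :> R by rewrite mulr_gt0// exprn_gt0.
have q0 : 0 <= (8 / 9) ^+ q :> R by rewrite exprn_ge0//; lra.
rewrite -exprVn; apply: lerXn2r; rewrite ?nnegrE// ?invr_ge0 ?(ltW d0)//.
rewrite -[leRHS]div1r ler_pdivlMr//.
by rewrite mulrC -mulrA; lra.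
Qed.

End SheetIncrements.

(** * Dyadic grids and deterministic chaining *)

Section DyadicGrid.
Variables (R : realType) (m : nat) (y : 'I_m -> R).
Hypothesis y0 : forall i, 0 <= y i.
Let T i : set R := `[0, y i]%classic.
Variable L : R.
Hypothesis yL : forall i, y i <= L.

Definition dyadic_pt p (k : 'I_m -> nat) : 'rV[R]_m :=
  \row_i (y i * ((k i)%:R / 2 ^+ p)).

(* When [y i = 0] the quotient is [0], which is the right value. *)
Definition dyadic_floor p (t : 'rV[R]_m) (i : 'I_m) : nat :=
  Num.truncn (2 ^+ p * (t ord0 i / y i)).

(** Required in every coordinate at once, so diagonal neighbours count: this is what rounding down
    leaves of two close points, and of one point seen at two consecutive levels. *)
Definition adjacent (a b : nat) := (a <= b.+1)%N && (b <= a.+1)%N.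

Lemma adjacent_dist a b : adjacent a b -> `|a%:R - b%:R| <= 1 :> R.
Proof.
move=> /andP[]; rewrite -!(ler_nat R) -!natr1 => h1 h2.
by rewrite ler_norml; lra.
Qed.

Lemma truncn_adjacent (a b : R) : 0 <= a -> 0 <= b -> `|a - b| <= 1 ->
  adjacent (Num.truncn a) (Num.truncn b).
Proof.
move=> a0 b0; rewrite ler_norml => ab.
have := truncn_itv a0; have := truncn_itv b0; rewrite -!natr1 => hb ha.
by apply/andP; split; rewrite -ltnS -(ltr_nat R) -!natr1; lra.
Qed.

Lemma truncn_double_adjacent (a : R) : 0 <= a ->
  adjacent (Num.truncn (2 * a)) (2 * Num.truncn a).
Proof.
move=> a0; have a20 : 0 <= 2 * a by rewrite mulr_ge0.
have := truncn_itv a0; have := truncn_itv a20; rewrite -!natr1 => hb ha.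
by apply/andP; split; rewrite -ltnS -(ltr_nat R) -!natr1 natrM; lra.
Qed.

Lemma dyadic_pt_box p k : (forall i, (k i <= 2 ^ p)%N) -> box T (dyadic_pt p k).
Proof.
move=> kp i; rewrite /T/= in_itv/= mxE mulr_ge0 ?divr_ge0 ?exprn_ge0//=.
by rewrite ler_piMr// ler_pdivrMr ?exprn_gt0// mul1r -natrX ler_nat.
Qed.

Lemma box_ratio t i : box T t -> 0 <= t ord0 i / y i <= 1.
Proof.
move=> /(_ i); rewrite /T/= in_itv/= => /andP[t0 ty]; rewrite divr_ge0//=.
have [->|yi0] := eqVneq (y i) 0; first by rewrite invr0 mulr0.
by rewrite ler_pdivrMr ?mul1r// lt_neqAle eq_sym yi0 y0.
Qed.

Lemma box_ratioK t i : box T t -> y i * (t ord0 i / y i) = t ord0 i.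
Proof.
move=> /(_ i); rewrite /T/= in_itv/= => /andP[t0 ty].
have [yi0|yi0] := eqVneq (y i) 0; last by rewrite mulrC divfK.
by rewrite yi0 mul0r; apply/eqP; rewrite eq_le t0 -yi0.
Qed.

Lemma dyadic_floor_le p t i : box T t -> (dyadic_floor p t i <= 2 ^ p)%N.
Proof.
move=> Tt; have /andP[t0 t1] := box_ratio i Tt.
rewrite /dyadic_floor truncn_le_nat -(natr1 (2 ^ p)) natrX.
by rewrite (@le_lt_trans _ _ (2 ^+ p))// ?ltrDl// ler_piMr// exprn_ge0.
Qed.

Lemma dyadic_floor_dist p t i : box T t ->
  `|t ord0 i - dyadic_pt p (dyadic_floor p t) ord0 i| <= L / 2 ^+ p.
Proof.
move=> Tt; have /andP[t0 t1] := box_ratio i Tt.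
rewrite mxE -[X in `|X - _|](box_ratioK i Tt) -mulrBr normrM (ger0_norm (y0 i)).
have p0 : 0 < 2 ^+ p :> R by rewrite exprn_gt0.
apply: ler_pM => //.
have /andP[h1 h2] := truncn_itv (mulr_ge0 (ltW p0) t0).
rewrite -[leRHS]div1r ler_pdivlMr// -[X in _ * X](gtr0_norm p0) -normrM.
rewrite mulrBl divfK ?gt_eqF// ler_norml /dyadic_floor.
by move: h2; rewrite -natr1; lra.
Qed.

Lemma adjacent_dyadic_dist p k k' i : adjacent (k i) (k' i) ->
  `|dyadic_pt p k ord0 i - dyadic_pt p k' ord0 i| <= L / 2 ^+ p.
Proof.
move=> kk; rewrite !mxE -mulrBr -mulrBl normrM (ger0_norm (y0 i)).
apply: ler_pM => //; have p0 : 0 <= (2 ^+ p)^-1 :> R by rewrite invr_ge0 exprn_ge0.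
by rewrite normrM (ger0_norm p0) ler_piMl// adjacent_dist.
Qed.

Lemma dyadic_pt_refine p k : dyadic_pt p k = dyadic_pt p.+1 (fun i => 2 * k i)%N.
Proof.
apply/rowP => i; rewrite !mxE natrM exprS; congr (_ * _).
by rewrite -mulf_div divff ?mul1r// pnatr_eq0.
Qed.

Section Chaining.
Variables (x : 'rV[R]_m -> R) (p0 : nat).
Hypothesis xp : forall p k k', (p0 <= p)%N ->
  (forall i, (k i <= 2 ^ p)%N) -> (forall i, (k' i <= 2 ^ p)%N) ->
  (forall i, adjacent (k i) (k' i)) ->
  `|x (dyadic_pt p k) - x (dyadic_pt p k')| <= (3 / 4) ^+ p.

Let xf p t := x (dyadic_pt p (dyadic_floor p t)).

(** Roundings of [t] at consecutive levels are adjacent on the finer grid, and the right-hand side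
    is the exact value of the geometric sum of [(3 / 4) ^+ r] over the levels [p < r <= p + n]. *)
Lemma dyadic_chain p n t : (p0 <= p)%N -> box T t ->
  `|xf (p + n) t - xf p t| <= 3 * ((3 / 4) ^+ p - (3 / 4) ^+ (p + n)).
Proof.
move=> pp Tt; elim: n => [|n IH]; first by rewrite addn0 !subrr normr0 mulr0.
have step : `|xf (p + n.+1) t - xf (p + n) t| <= (3 / 4) ^+ (p + n.+1).
  rewrite /xf [in X in _ - x X]dyadic_pt_refine -addnS; apply: xp.
  - by rewrite (leq_trans pp)// leq_addr.
  - by move=> i; exact: dyadic_floor_le.
  - by move=> i; rewrite addnS expnS leq_mul2l /= dyadic_floor_le.
  move=> i; rewrite /dyadic_floor addnS exprS -mulrA.
  apply: truncn_double_adjacent; rewrite mulr_ge0 ?exprn_ge0//.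
  by have /andP[] := box_ratio i Tt.
have := ler_normD (xf (p + n.+1) t - xf (p + n) t) (xf (p + n) t - xf p t).
rewrite addrA subrK => /le_trans; apply.
apply: (le_trans (lerD step IH)); rewrite addnS exprS; lra.
Qed.

Lemma dyadic_limit p t : (p0 <= p)%N -> box T t ->
  (forall e, 0 < e -> exists q, forall n, (q <= n)%N -> `|x t - xf n t| <= e) ->
  `|x t - xf p t| <= 3 * (3 / 4) ^+ p.
Proof.
move=> pp Tt lim; apply/ler_addgt0Pr => e e0.
have [q hq] := lim e e0.
have h1 := hq (p + q)%N (leq_addl _ _).
have h2 := dyadic_chain q pp Tt.
have h3 : 0 <= (3 / 4) ^+ (p + q) :> R by rewrite exprn_ge0//; lra.
have := ler_normD (x t - xf (p + q) t) (xf (p + q) t - xf p t).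
by rewrite addrA subrK; lra.
Qed.

(** The constant is [3 + 1 + 3]: a chain from each point down to level [p], and one step between the
    two roundings, which are adjacent there. *)
Lemma dyadic_modulus p s t : (p0 <= p)%N -> box T s -> box T t ->
  (forall e, 0 < e -> exists q, forall n, (q <= n)%N -> `|x s - xf n s| <= e) ->
  (forall e, 0 < e -> exists q, forall n, (q <= n)%N -> `|x t - xf n t| <= e) ->
  (forall i, `|s ord0 i / y i - t ord0 i / y i| <= (2 ^+ p)^-1) ->
  `|x s - x t| <= 7 * (3 / 4) ^+ p.
Proof.
move=> pp Ts Tt ls lt st.
have h1 := dyadic_limit pp Ts ls; have h2 := dyadic_limit pp Tt lt.
have h3 : `|xf p s - xf p t| <= (3 / 4) ^+ p.
  apply: xp => // i; try exact: dyadic_floor_le.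
  have p2 : 0 < 2 ^+ p :> R by rewrite exprn_gt0.
  have /andP[s0 _] := box_ratio i Ts; have /andP[t0 _] := box_ratio i Tt.
  apply: truncn_adjacent; [exact: mulr_ge0 (ltW p2) s0|exact: mulr_ge0 (ltW p2) t0|].
  by rewrite -mulrBr normrM gtr0_norm// mulrC -ler_pdivlMr// div1r.
have := ler_normD (x s - xf p s) (xf p s - xf p t).
have := ler_normD (x s - xf p s + (xf p s - xf p t)) (xf p t - x t).
rewrite (_ : x s - xf p s + (xf p s - xf p t) + (xf p t - x t) = x s - x t); last by ring.
rewrite (distrC (xf p t)); lra.
Qed.

End Chaining.
End DyadicGrid.

(** * Almost sure bounds on dyadic increments *)

Section SheetContinuity.
Context (R : realType) (d : measure_display) (Om : measurableType d).
Variables (P : probability Om R) (m : nat) (y : 'I_m -> R).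
Hypothesis y0 : forall i, 0 <= y i.
Let T i : set R := `[0, y i]%classic.
Variable X : 'rV[R]_m -> Om -> R.
Hypothesis hX : brownian_sheet P T X.

Let gap p s t : set Om := [set w | (3 / 4) ^+ p <= `|X s w - X t w|].

Let measurable_gap p s t : box T s -> box T t -> measurable (gap p s t).
Proof.
move=> Ts Tt.
rewrite (_ : gap p s t = (fun w => `|X s w - X t w|) @^-1` `[(3 / 4) ^+ p, +oo[%classic).
  rewrite -[X in measurable X]setTI.
  apply: (measurableT_comp (@normr_measurable R setT)) => //.
  by apply: measurable_funB; exact: (sheet_measurable hX).
by apply/seteqP; split => w /=; rewrite in_itv/= andbT.
Qed.

Let y_bound : exists2 L, 1 <= L & forall i, y i <= L.
Proof.
exists (1 + \sum_i y i); first by rewrite lerDl sumr_ge0.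
by move=> i; rewrite (bigD1 i)//= addrCA lerDl addr_ge0// sumr_ge0.
Qed.

(** Chaining controls grid points only, so points of the separant have to be tied to their
    roundings. The null set depends on [t], which is affordable because the separant is
    countable. *)
Lemma sheet_dyadic_approx t : box T t ->
  P.-negligible (lim_sup_set (fun p => gap p t (dyadic_pt y p (dyadic_floor y p t)))).
Proof.
move=> Tt; have [L L1 yL] := y_bound.
have [K K0 HK] := sheet_dyadic_tail hX L1 yL.
have Tf p : box T (dyadic_pt y p (dyadic_floor y p t)).
  by apply: dyadic_pt_box => // i; exact: dyadic_floor_le.
apply: (@borel_cantelli_half _ _ _ _ _ K) => p; first exact: measurable_gap.
apply: le_trans (HK p t _ Tt (Tf p) _) _ => [i|]; first exact: dyadic_floor_dist.
rewrite lee_fin ler_wpM2l// lef_pV2 ?posrE ?exprn_gt0 ?mulr_gt0 ?exprn_gt0//.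
by rewrite lerXn2r ?nnegrE ?mulr_ge0 ?exprn_ge0// ler_peMr// exprn_ege1// ler1n.
Qed.

Let grid p := {ffun 'I_m -> 'I_(2 ^ p).+1}.

Let pair_gap p (k : grid p * grid p) : set Om :=
  if [forall i, adjacent (k.1 i) (k.2 i)]
  then gap p (dyadic_pt y p (fun i => k.1 i)) (dyadic_pt y p (fun i => k.2 i))
  else set0.

(** There are [(2 ^ p + 1) ^ (2 * m)] pairs of grid points, at most [4 ^ m] times the [p]-th power
    of [4 ^ m]; the tail bound cancels that power and leaves a summable [2 ^ - p]. *)
Lemma sheet_dyadic_increments : P.-negligible (lim_sup_set
  (fun p => \big[setU/set0]_(k <- enum {: grid p * grid p}) pair_gap k)).
Proof.
have [L L1 yL] := y_bound.
have [K K0 HK] := sheet_dyadic_tail hX L1 yL.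
have Tk p (k : grid p) : box T (dyadic_pt y p (fun i => k i)).
  by apply: dyadic_pt_box => // i; rewrite -ltnS.
have mg p (k : grid p * grid p) : measurable (pair_gap k).
  by rewrite /pair_gap; case: ifP => // _; exact: measurable_gap.
apply: (@borel_cantelli_half _ _ _ _ _ (4 ^+ m * K)) => p.
  exact: bigsetU_measurable.
apply: (le_trans (@prob_bigsetU_le _ _ _ P _ _ (@pair_gap p) (K / (2 * 4 ^+ m) ^+ p) (mg p) _)).
  move=> k; rewrite /pair_gap; case: ifP => [/forallP kk|_]; last first.
    by rewrite measure0 lee_fin divr_ge0 ?exprn_ge0// mulr_ge0 ?exprn_ge0.
  by apply: HK => // i; exact: adjacent_dyadic_dist.
rewrite -cardT card_prod card_ffun !card_ord lee_fin natrM natrX -natr1 natrX.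
set a : R := 2 ^+ p.
have a1 : 1 <= a by rewrite exprn_ege1// ler1n.
have h : (a + 1) ^+ m * (a + 1) ^+ m <= 4 ^+ m * (4 ^+ m) ^+ p.
  rewrite -exprMn -exprM mulnC exprM -exprMn lerXn2r ?nnegrE ?mulr_ge0 ?exprn_ge0//.
  - by rewrite addr_ge0// (le_trans _ a1).
  - by rewrite addr_ge0// (le_trans _ a1).
  have -> : 4 ^+ p = a ^+ 2 :> R by rewrite /a -exprM mulnC exprM; congr (_ ^+ _); ring.
  nra.
have c0 : 0 < (2 * 4 ^+ m) ^+ p :> R by rewrite exprn_gt0// mulr_gt0// exprn_gt0.
rewrite mulrA ler_pdivrMr//.
have -> : 4 ^+ m * K / a * (2 * 4 ^+ m) ^+ p = 4 ^+ m * (4 ^+ m) ^+ p * K.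
  by rewrite exprMn -/a; field; rewrite gt_eqF// (lt_le_trans _ a1).
exact: ler_wpM2r.
Qed.

End SheetContinuity.

(** * Almost sure continuity of the paths *)

Section SheetPaths.
Context (R : realType) (d : measure_display) (Om : measurableType d).
Variables (P : probability Om R) (m : nat) (y : 'I_m -> R).
Hypothesis y0 : forall i, 0 <= y i.
Let T i : set R := `[0, y i]%classic.
Variable X : 'rV[R]_m -> Om -> R.
Hypothesis hX : brownian_sheet P T X.

(* The chaining bound holds a.s. on the separant, and Doob's condition
   transfers it to all points of the box. *)
Lemma sheet_continuous : exists2 N, P.-negligible N &
  forall w, ~ N w -> forall t, box T t ->
    X s w @[s --> within (box T) (nbhs t)] --> X t w.
Proof.
have [Q [N1 [cQ QT TQ N10 sep]]] := bs_separable hX.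
have N2 := sheet_dyadic_increments y0 hX.
set B := (fun p => _) in N2.
pose A t := lim_sup_set (fun p => [set w |
  (3 / 4) ^+ p <= `|X t w - X (dyadic_pt y p (dyadic_floor y p t)) w|]).
have N3 : P.-negligible [set w | exists2 t, Q t & A t w].
  apply: negligible_countable => // t Qt.
  by apply: (sheet_dyadic_approx y0 hX); exact: QT.
exists (N1 `|` lim_sup_set B `|` [set w | exists2 t, Q t & A t w]).
  by apply: negligibleU => //; exact: negligibleU.
move=> w nN t Tt.
have nN1 : ~ N1 w by move=> h; apply: nN; left; left.
have nN2 : ~ lim_sup_set B w by move=> h; apply: nN; left; right.
have nN3 s : Q s -> ~ A s w by move=> Qs h; apply: nN; right; exists s.
have r0 p : 0 < (3 / 4) ^+ p :> R by rewrite exprn_gt0//; lra.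
have [p0 hp0] : exists p0, forall p, (p0 <= p)%N -> ~ B p w.
  apply/not_existsP => h; apply: nN2 => p _ /=.
  have /existsNP[q /not_implyP[pq /contrapT Bq]] := h p.
  by exists q.
have xp p k k' : (p0 <= p)%N ->
    (forall i, (k i <= 2 ^ p)%N) -> (forall i, (k' i <= 2 ^ p)%N) ->
    (forall i, adjacent (k i) (k' i)) ->
    `|X (dyadic_pt y p k) w - X (dyadic_pt y p k') w| <= (3 / 4) ^+ p.
  move=> pp kp k'p kk; rewrite leNgt; apply/negP => hlt; apply: (hp0 p pp).
  pose K : {ffun 'I_m -> 'I_(2 ^ p).+1} := [ffun i => inord (k i)].
  pose K' : {ffun 'I_m -> 'I_(2 ^ p).+1} := [ffun i => inord (k' i)].
  rewrite /B -bigcup_seq; exists (K, K'); first by rewrite /= mem_enum.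
  have KE : (fun i => K i : nat) = k.
    by apply/funext => i; rewrite ffunE inordK// ltnS.
  have K'E : (fun i => K' i : nat) = k'.
    by apply/funext => i; rewrite ffunE inordK// ltnS.
  have kkE : [forall i, adjacent (K i) (K' i)].
    by apply/forallP => i; rewrite !ffunE !inordK ?ltnS.
  by rewrite /= kkE KE K'E /= ltW.
have lim s : Q s -> forall e, 0 < e -> exists q, forall n, (q <= n)%N ->
    `|X s w - X (dyadic_pt y n (dyadic_floor y n s)) w| <= e.
  move=> Qs e e0.
  have [q1 hq1] : exists q, forall n, (q <= n)%N ->
      `|X s w - X (dyadic_pt y n (dyadic_floor y n s)) w| <= (3 / 4) ^+ n.
    apply/not_existsP => h; apply: (nN3 _ Qs) => p _ /=.
    have /existsNP[q /not_implyP[pq /negP]] := h p.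
    by rewrite -ltNge => hq; exists q => //=; rewrite ltW.
  have hn : \forall n \near \oo, `|(3 / 4) ^+ n| <= e :> R.
    apply: (cvgr0_norm_le (fun n => (3 / 4) ^+ n : R)) => //.
    by apply: cvg_expr; rewrite ger0_norm; lra.
  have [q2 _ hq2] := hn.
  exists (maxn q1 q2) => n; rewrite geq_max => /andP[n1 n2].
  by rewrite (le_trans (hq1 n n1))// (le_trans _ (hq2 n n2))// ler_norm.
apply/cvgrPdist_le => e e0.
(* Both [t] and the nearby point will be within [7 * (3 / 4) ^+ p] of the value at one separant
   point, hence [14]. *)
have [p [pp pe]] : exists p, (p0 <= p)%N /\ 14 * (3 / 4) ^+ p <= e.
  have hn : \forall n \near \oo, `|(3 / 4) ^+ n| <= e / 14 :> R.
    apply: (cvgr0_norm_le (fun n => (3 / 4) ^+ n : R)); last by rewrite divr_gt0.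
    by apply: cvg_expr; rewrite ger0_norm; lra.
  have [q _ hq] := hn.
  exists (maxn p0 q); split; first exact: leq_maxl.
  have := hq _ (leq_maxr p0 q); rewrite /= ger0_norm ?(ltW (r0 _))//.
  by rewrite ler_pdivlMr// mulrC.
(* Half the radius allowed by [dyadic_modulus], so that any two points of [V] are close enough to
   each other. *)
pose V : set 'rV[R]_m :=
  [set s | forall i, `|s ord0 i / y i - t ord0 i / y i| <= (2 * 2 ^+ p)^-1].
have Vt : nbhs t V.
  have FF : Filter (nbhs t) by exact: nbhs_filter.
  pose W (i : 'I_m) : set 'rV[R]_m :=
    [set s | `|s ord0 i / y i - t ord0 i / y i| <= (2 * 2 ^+ p)^-1].
  suff W_t i : nbhs t (W i) by exact: (@filter_forall _ _ W _ FF W_t).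
  have c : (fun s : 'rV[R]_m => s ord0 i / y i) @ t --> t ord0 i / y i.
    by apply: cvgM; [exact: coord_continuous|exact: cvg_cst].
  move/cvgrPdist_le : c => /(_ (2 * 2 ^+ p)^-1) /=.
  rewrite invr_gt0 mulr_gt0 ?exprn_gt0// => /(_ isT).
  by apply: filterS => s; rewrite distrC.
pose U := interior V.
have Ut : nbhs t U by exact/nbhs_interior.
(* Doob's condition takes one open set and one closed set, so all values near [t] are confined to a
   closed interval around the value at a single separant point. *)
have [q0 [Qq0 Uq0]] := TQ _ Tt _ Ut.
pose C : set R := `[X q0 w - 7 * (3 / 4) ^+ p, X q0 w + 7 * (3 / 4) ^+ p]%classic.
have UQ s : U s -> Q s -> C (X s w).
  move=> Us Qs; rewrite /C/= in_itv/=.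
  have : `|X s w - X q0 w| <= 7 * (3 / 4) ^+ p.
    apply: (@dyadic_modulus _ _ _ y0 (X ^~ w) p0 xp p s q0 pp (QT _ Qs) (QT _ Qq0)
      (lim s Qs) (lim q0 Qq0)) => i.
    have h1 := interior_subset Us i; have h2 := interior_subset Uq0 i.
    have := ler_distD (t ord0 i / y i) (s ord0 i / y i) (q0 ord0 i / y i).
    rewrite (distrC (t ord0 i / y i)) => /le_trans; apply.
    apply: (le_trans (lerD h1 h2)).
    by rewrite invfM; lra.
  by rewrite ler_norml; lra.
have cC : closed C by exact: itv_closed.
have UT := sep w nN1 U C (@open_interior _ V) cC UQ.
have h t' : U t' -> box T t' -> `|X t' w - X q0 w| <= 7 * (3 / 4) ^+ p.
  move=> Ut' Tt'; have := UT t' Ut' Tt'; rewrite /C/= in_itv/= ler_norml; lra.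
have ht := h t (nbhs_singleton Ut) Tt.
rewrite near_withinE; apply: filterS Ut => s Us Ts.
have hs := h s Us Ts.
have := ler_distD (X q0 w) (X t w) (X s w).
rewrite (distrC (X q0 w)); lra.
Qed.

End SheetPaths.

(** * The surface and its time change *)

Section ContinuityTools.
Variable R : realType.

Lemma cvg_row n (I : Type) (F : set_system I) (FF : Filter F)
    (h : I -> 'rV[R]_n) (v : 'rV[R]_n) :
  (forall l, h u ord0 l @[u --> F] --> v ord0 l) -> h @ F --> v.
Proof.
move=> hv A /nbhs_ballP[e /= e0 eA].
pose W (l : 'I_n) : set I := [set u | ball (v ord0 l) e (h u ord0 l)].
have FW l : F (W l) by apply: (hv l); exact: nbhsx_ballx.
have := @filter_forall _ _ W F FF FW.
apply: filterS => u Wu; apply: eA; split => // i l; rewrite ord1; exact: Wu.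
Qed.

Lemma cvg_within_comp (S T : topologicalType) (A : set S) (B : set T)
    (h : S -> T) (s : S) :
  (forall u, A u -> B (h u)) ->
  h @ within A (nbhs s) --> h s ->
  h @ within A (nbhs s) --> within B (nbhs (h s)).
Proof.
move=> AB hs C BC; have := hs _ BC; rewrite /nbhs/= /within/=.
by apply: filterS => u Hu Au; apply: Hu => //; exact: AB.
Qed.

End ContinuityTools.

Section TimeChange.
Variables (R : realType) (y x : R) (z a b : R -> R).
Hypotheses (y0 : 0 <= y) (z0 : forall s, s \in `[0, y] -> 0 < z s).
Hypothesis z_decr : {in `[0, y] &, nonincreasing_fun z}.
Hypothesis aE : forall t, t \in `[0, y] -> a t = t / z t.
Hypothesis xE : x = a y.
Hypothesis ab : inverse_on `[0, y] `[0, x] a b.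

Lemma time_change_mono : {in `[0, y] &, {mono a : u v / u <= v}}.
Proof.
apply: le_mono_in => u v uy vy uv; rewrite !aE//.
have u0 : 0 <= u by move: uy; rewrite in_itv => /andP[].
have zv := z0 vy; have zu := z0 uy; have := z_decr uy vy (ltW uv) => zz.
apply: (@le_lt_trans _ _ (u / z v)); last by rewrite ltr_pM2r ?invr_gt0.
by rewrite ler_wpM2l// lef_pV2 ?posrE.
Qed.

(** A strictly increasing map onto an interval has no jumps; the inverse [b] supplies the
    surjectivity. *)
Lemma time_change_continuous t : t \in `[0, y] ->
  a s @[s --> within `[0, y]%classic (nbhs t)] --> a t.
Proof.
move=> ty; have y00 : 0 \in `[0, y] by rewrite in_itv/= lexx.
have ca : {within `[0, y], continuous a}.
  apply: segment_inc_surj_continuous; first exact: time_change_mono.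
  move=> v /=; rewrite aE// mul0r -xE => vx.
  have [_ bv _ avK] := ab.
  by exists (b v); [exact: bv|exact: avK].
by move/subspace_continuousP : ca; apply.
Qed.

(** Follows from [z s = s / a s], a formula that determines [z] only for [s > 0]. *)
Lemma weight_continuous t : t \in `]0, y] ->
  z s @[s --> within `[0, y]%classic (nbhs t)] --> z t.
Proof.
rewrite in_itv/= => /andP[t0 ty].
have tI : t \in `[0, y] by rewrite in_itv/= ltW.
have zE s : s \in `[0, y] -> 0 < s -> z s = s / a s.
  move=> sy s0; rewrite aE// invfM invrK mulrA divff ?mul1r// gt_eqF//.
have at0 : a t != 0 by rewrite aE// mulf_neq0// ?invr_eq0 gt_eqF// z0.
have c : s / a s @[s --> within `[0, y]%classic (nbhs t)] --> t / a t.
  apply: cvgM; first exact: cvg_within.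
  by apply: cvgV => //; exact: time_change_continuous.
rewrite (zE _ tI t0); apply: cvg_trans c; apply: near_eq_cvg.
rewrite near_withinE; have : \forall s \near t, 0 < s by exact: lt_nbhsr.
apply: filterS => s s0 sy; rewrite zE//.
Qed.

End TimeChange.

Section FactorContinuity.
Variable R : realType.

(* If [f * r = C * z] with [f] and [r] both nonincreasing, then [f] cannot
   oscillate more than [z] does, in relative terms. *)
Lemma factor_increment (A : set R) (f r z : R -> R) (C : R) (s t : R) :
  0 < C -> (forall u, A u -> 0 <= f u) -> (forall u, A u -> 0 < r u) ->
  (forall u, A u -> 0 < z u) ->
  (forall u v, A u -> A v -> u <= v -> f v <= f u) ->
  (forall u v, A u -> A v -> u <= v -> r v <= r u) ->
  (forall u, A u -> f u * r u = C * z u) -> A s -> A t ->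
  `|f s - f t| <= f t / z t * `|z s - z t|.
Proof.
move=> C0 f0 r0 z0 fd rd fr As At.
have zt := z0 t At; have ft := f0 t At; have rs := r0 s As.
have zs := z0 s As.
have cross : f s * r s * z t = f t * r t * z s by rewrite !fr//; ring.
rewrite mulrAC ler_pdivlMr//.
have [ts|st] := leP t s.
  have h : f t * z s <= f s * z t.
    rewrite -(ler_pM2r rs) (_ : f s * z t * r s = f s * r s * z t); last by ring.
    rewrite cross (_ : f t * z s * r s = f t * z s * r s)// mulrAC.
    by rewrite ler_wpM2r ?(ltW zs)// ler_wpM2l// rd.
  rewrite distrC (distrC (z s)) ger0_norm ?subr_ge0 ?fd//.
  apply: (@le_trans _ _ (f t * (z t - z s))); first lra.
  by rewrite ler_wpM2l// ler_norm.
have h : f s * z t <= f t * z s.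
  rewrite -(ler_pM2r rs) (_ : f s * z t * r s = f s * r s * z t); last by ring.
  rewrite cross [leRHS]mulrAC.
  by rewrite ler_wpM2r ?(ltW zs)// ler_wpM2l// rd// ltW.
have fts : f t <= f s by apply: fd => //; exact: ltW.
rewrite ger0_norm ?subr_ge0//.
apply: (@le_trans _ _ (f t * (z s - z t))); first lra.
by rewrite ler_wpM2l// ler_norm.
Qed.

End FactorContinuity.

(** * The surface, its parametrization and its covariance *)

Section Surface.
Variables (R : realType) (d m : nat).
Variables (y : 'I_(d + m) -> R) (j : 'I_m -> 'I_d) (f : 'I_m -> R -> R).
Hypothesis y_ge0 : forall i, 0 <= y i.
Hypothesis f_range : forall k,
  set_fun `[0, y (lshift m (j k))] `[0, y (rshift d k)] (f k).
Hypothesis f_decr : forall k,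
  {in `[0, y (lshift m (j k))] &, nonincreasing_fun (f k)}.
Variable z : 'I_d -> R -> R.
Hypothesis z_gt0 : forall i s, s \in `[0, y (lshift m i)] -> 0 < z i s.
Hypothesis z_decr : forall i,
  {in `[0, y (lshift m i)] &, nonincreasing_fun (z i)}.
Hypothesis prod_fz : forall s : 'rV[R]_d,
  (forall i, s ord0 i \in `[0, y (lshift m i)]) ->
  \prod_(k < m) f k (s ord0 (j k)) = \prod_(i < d) z i (s ord0 i).
Variable a : 'I_d -> R -> R.
Hypothesis aE : forall i t, t \in `[0, y (lshift m i)] -> a i t = t / z i t.
Variable x : 'I_d -> R.
Hypothesis xE : forall i, x i = a i (y (lshift m i)).
Variable ainv : 'I_d -> R -> R.
Hypothesis aK : forall i,
  inverse_on `[0, y (lshift m i)] `[0, x i] (a i) (ainv i).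

Let yd i := y (lshift m i).
Let D : set 'rV[R]_d := box (fun i => `[0, yd i]%classic).
Let D' : set 'rV[R]_d := box (fun i => `[0, x i]%classic).
Let D0 : set 'rV[R]_d := [set s | D s /\ forall i, 0 < s ord0 i].

Definition surface_pt (s : 'rV[R]_d) : 'rV[R]_(d + m) :=
  row_mx s (\row_k f k (s ord0 (j k))).

Definition time_change (s : 'rV[R]_d) : 'rV[R]_d := \row_i a i (s ord0 i).

Definition weight (s : 'rV[R]_d) : R := \prod_(i < d) z i (s ord0 i).

Let D_in s i : D s -> s ord0 i \in `[0, yd i]. Proof. exact. Qed.

Let zero_in i : 0 \in `[0, yd i].
Proof. by rewrite in_itv/= lexx y_ge0. Qed.

Lemma surface_pt_box s : D s -> boxG y (surface_pt s).
Proof.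
move=> Ds i; rewrite /surface_pt mxE; case: splitP => [i' ii'|k kk].
  by rewrite (_ : i = lshift m i'); [exact: Ds|exact: val_inj].
rewrite (_ : i = rshift d k); last exact: val_inj.
by rewrite mxE; apply: f_range; exact: Ds.
Qed.

Lemma setS_surface t : setS y j f t <-> exists2 s, D s & t = surface_pt s.
Proof.
split => [[Gt tf]|[s Ds ->]].
  exists (lsubmx t).
    by move=> i; rewrite mxE; exact: Gt.
  rewrite -[LHS]hsubmxK /surface_pt; congr row_mx.
  by apply/rowP => k; rewrite !mxE tf.
split; first exact: surface_pt_box.
by move=> k; rewrite /surface_pt row_mxEr row_mxEl mxE.
Qed.

Lemma time_change_box s : D s -> D' (time_change s).
Proof. by move=> Ds i; rewrite mxE; have [h _ _ _] := aK i; apply: h; exact: Ds. Qed.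

Lemma weight_gt0 s : D s -> 0 < weight s.
Proof. by move=> Ds; apply: prodr_gt0 => i _; apply: z_gt0; exact: D_in. Qed.

(** By monotonicity the extremes of each [z i] sit at the ends of its interval. The two bounds carry
    a negative margin across multiplication by the weight and back. *)
Lemma weight_bounds : exists c C, [/\ 0 < c, 0 < C &
  forall s, D s -> c <= weight s <= C].
Proof.
have y_in i : yd i \in `[0, yd i] by rewrite in_itv/= lexx y_ge0.
exists (\prod_(i < d) z i (yd i)), (\prod_(i < d) z i 0); split.
- by apply: prodr_gt0 => i _; exact: z_gt0.
- by apply: prodr_gt0 => i _; apply: z_gt0; exact: zero_in.
move=> s Ds; apply/andP; split; apply: ler_prod => i _; have si := D_in i Ds.
  rewrite (ltW (z_gt0 _))//=; apply: z_decr => //.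
  by move: si; rewrite in_itv => /andP[].
rewrite (ltW (z_gt0 _))//=; apply: z_decr => //; first exact: zero_in.
by move: si; rewrite in_itv => /andP[].
Qed.

(** With all coordinates except [j k] frozen at [0], the product formula reads
    [f k u * r u = C * z (j k) u]. The cofactor [r] may still vary, since other heights can depend
    on the same coordinate, but it is nonincreasing, and positive because the right-hand side is;
    [factor_increment] then transfers the continuity of [z (j k)] to [f k]. *)
Lemma height_continuous k t : t \in `]0, yd (j k)] ->
  f k s @[s --> within `[0, yd (j k)]%classic (nbhs t)] --> f k t.
Proof.
move=> tI; have /andP[t0 ty] : 0 < t <= yd (j k) by move: tI; rewrite in_itv.
have tJ : t \in `[0, yd (j k)] by rewrite in_itv/= (ltW t0).
pose v (u : R) : 'rV[R]_d := \row_i (if i == j k then u else 0).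
have v_in u : u \in `[0, yd (j k)] -> forall i, v u ord0 i \in `[0, yd i].
  by move=> uI i; rewrite mxE; case: eqP => [->|_]//; exact: zero_in.
pose r u := \prod_(k' < m | k' != k) f k' (v u ord0 (j k')).
pose C := \prod_(i < d | i != j k) z i 0.
have C0 : 0 < C by apply: prodr_gt0 => i _; apply: z_gt0; exact: zero_in.
have f_ge0 k' u : u \in `[0, yd (j k')] -> 0 <= f k' u.
  by move=> uI; have := f_range uI; rewrite /= in_itv/= => /andP[].
have fr u : u \in `[0, yd (j k)] -> f k u * r u = C * z (j k) u.
  move=> uI; have := prod_fz (v_in u uI).
  rewrite (bigD1 k)//= (bigD1 (j k))//= mxE eqxx => ->.
  rewrite mulrC; congr (_ * _).
  by apply: eq_bigr => i /negbTE ik; rewrite mxE ik.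
have r0 u : u \in `[0, yd (j k)] -> 0 < r u.
  move=> uI; rewrite lt_neqAle; apply/andP; split; last first.
    by apply: prodr_ge0 => k' _; apply: f_ge0; exact: v_in.
  apply/eqP => ru0; have := fr u uI; rewrite -ru0 mulr0 => /esym/eqP.
  by rewrite gt_eqF// mulr_gt0// z_gt0.
have inc s : s \in `[0, yd (j k)] ->
    `|f k s - f k t| <= f k t / z (j k) t * `|z (j k) s - z (j k) t|.
  move=> sI; apply: (@factor_increment _ [set u | u \in `[0, yd (j k)]] _ r _ C) => //.
  - by move=> u; exact: f_ge0.
  - by move=> u; exact: z_gt0.
  - by move=> u w uI wI; exact: f_decr.
  move=> u w uI wI uw; apply: ler_prod => k' _.
  rewrite f_ge0//=; last exact: v_in.
  apply: f_decr; try exact: v_in.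
  by rewrite !mxE; case: ifP.
have cz := weight_continuous (y_ge0 _) (@z_gt0 (j k)) (@z_decr (j k))
  (@aE (j k)) (xE (j k)) (aK (j k)) tI.
apply/cvgrPdist_le => e e0.
pose K := f k t / z (j k) t.
have K0 : 0 <= K by rewrite divr_ge0 ?f_ge0// ltW// z_gt0.
move/cvgrPdist_le : cz => /(_ (e / (1 + K))).
rewrite divr_gt0 ?ltr_pwDl// => /(_ isT).
rewrite !near_withinE; apply: filterS => s H sI.
have := H sI; rewrite distrC => h; rewrite distrC.
apply: (le_trans (inc s sI)); apply: (le_trans (ler_wpM2l K0 h)).
rewrite mulrCA ler_piMr ?(ltW e0)// ler_pdivrMr ?ltr_pwDl// mul1r.
by rewrite lerDr.
Qed.

Let cvg_coord (s : 'rV[R]_d) (i : 'I_d) (h : R -> R) : D s ->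
  h u @[u --> within `[0, yd i]%classic (nbhs (s ord0 i))] --> h (s ord0 i) ->
  h (u ord0 i) @[u --> within D (nbhs s)] --> h (s ord0 i).
Proof.
move=> Ds hc A /hc; rewrite /nbhs/= /within/= => sA.
have c : (fun u : 'rV[R]_d => u ord0 i) @ s --> s ord0 i by exact: coord_continuous.
have sA' : nbhs s [set u : 'rV[R]_d |
    `[0, yd i]%classic (u ord0 i) -> A (h (u ord0 i))].
  exact: (c _ sA).
by apply: filterS sA' => u Hu Du; apply: Hu; exact: Du.
Qed.

Lemma surface_pt_continuous s : D0 s ->
  surface_pt @ within D (nbhs s) --> surface_pt s.
Proof.
move=> [Ds s0]; apply: cvg_row => l; rewrite /surface_pt mxE.
under eq_fun do rewrite mxE.
case: splitP => [i _|k _].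
  apply: (@cvg_coord s i id Ds); exact: cvg_within.
rewrite mxE; under eq_fun do rewrite mxE.
apply: (@cvg_coord s (j k) (f k) Ds); apply: height_continuous.
by have := D_in (j k) Ds; rewrite !in_itv/= s0 => /andP[].
Qed.

Lemma time_change_row_continuous s : D s ->
  time_change @ within D (nbhs s) --> time_change s.
Proof.
move=> Ds; apply: cvg_row => i; rewrite /time_change mxE.
under eq_fun do rewrite mxE.
apply: (@cvg_coord s i (a i) Ds).
apply: (time_change_continuous (y_ge0 _) (@z_gt0 i) (@z_decr i) (@aE i) (xE i) (aK i)).
exact: D_in.
Qed.

Lemma weight_row_continuous s : D0 s -> weight @ within D (nbhs s) --> weight s.
Proof.
move=> [Ds s0]; rewrite /weight.
elim: (index_enum _) => [|i l IH].
  by rewrite big_nil; under eq_fun do rewrite big_nil; exact: cvg_cst.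
rewrite big_cons; under eq_fun do rewrite big_cons.
apply: cvgM => //; apply: (@cvg_coord s i (z i) Ds).
apply: (weight_continuous (y_ge0 _) (@z_gt0 i) (@z_decr i) (@aE i) (xE i) (aK i)).
by have := D_in i Ds; rewrite !in_itv/= s0 => /andP[].
Qed.

(* [f_k] is nonincreasing, so [min (f_k u) (f_k v) = f_k (max u v)]; the
   product formula then turns the last [m] covariance factors into
   [z_i (max u v)], and [min u v * z (max u v) = z u * z v * min (a u) (a v)]. *)
Lemma surface_cov s t : D s -> D t ->
  sheet_cov (surface_pt s) (surface_pt t) =
  weight s * weight t * sheet_cov (time_change s) (time_change t).
Proof.
move=> Ds Dt; rewrite /sheet_cov big_split_ord /=.
pose mx : 'rV[R]_d := \row_i Num.max (s ord0 i) (t ord0 i).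
have mx_in i : mx ord0 i \in `[0, yd i].
  by rewrite mxE maxEle; case: ifP => _; exact: D_in.
have -> : \prod_(k < m) Num.min (surface_pt s ord0 (rshift d k))
      (surface_pt t ord0 (rshift d k)) = \prod_(i < d) z i (mx ord0 i).
  rewrite -prod_fz//; apply: eq_bigr => k _.
  rewrite /surface_pt !row_mxEr !mxE.
  have [h|h] := leP (s ord0 (j k)) (t ord0 (j k)).
    by apply/min_idPr; apply: f_decr => //; exact: D_in.
  by apply/min_idPl; apply: f_decr; [exact: D_in|exact: D_in|exact: ltW].
rewrite /weight -!big_split/=; apply: eq_bigr => i _.
rewrite /surface_pt !row_mxEl !mxE.
have si := D_in i Ds; have ti := D_in i Dt.
have zs := z_gt0 si; have zt := z_gt0 ti.
have amono := time_change_mono (@z_gt0 i) (@z_decr i) (@aE i).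
have zs' : z i (s ord0 i) != 0 by rewrite gt_eqF.
have zt' : z i (t ord0 i) != 0 by rewrite gt_eqF.
have [h|h] := leP (s ord0 i) (t ord0 i).
  rewrite (min_idPl _); first by rewrite aE//; field.
  by rewrite amono.
rewrite (min_idPr _); first by rewrite aE//; field.
by rewrite amono// ltW.
Qed.

Lemma surface_pt_prod0 s : D s -> ~ D0 s ->
  \prod_(i < d + m) surface_pt s ord0 i = 0.
Proof.
move=> Ds nD0; have [i] : exists i, s ord0 i = 0.
  apply/not_existsP => h; apply: nD0; split => // i.
  have := D_in i Ds; rewrite in_itv/= => /andP[s0 _].
  by rewrite lt_neqAle s0 andbT eq_sym; apply/eqP; exact: h.
by move=> si; rewrite (bigD1 (lshift m i))//= /surface_pt row_mxEl si mul0r.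
Qed.

Lemma time_change_prod0 s : D s -> ~ D0 s ->
  \prod_(i < d) time_change s ord0 i = 0.
Proof.
move=> Ds nD0; have [i] : exists i, s ord0 i = 0.
  apply/not_existsP => h; apply: nD0; split => // i.
  have := D_in i Ds; rewrite in_itv/= => /andP[s0 _].
  by rewrite lt_neqAle s0 andbT eq_sym; apply/eqP; exact: h.
move=> si; rewrite (bigD1 i)//= mxE aE; last exact: D_in.
by rewrite si !mul0r.
Qed.

(** Enumerates the grid points of all levels. Codes that name no grid point are sent to [0], which
    lies in the box, so that the whole sequence does. *)
Definition dyadic_seq (r : nat) : 'rV[R]_d :=
  match @unpickle (nat * {ffun 'I_d -> nat})%type r with
  | Some (p, k) => if [forall i, (k i <= 2 ^ p)%N] then dyadic_pt yd p k else 0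
  | None => 0
  end.

Lemma dyadic_seq_box r : D (dyadic_seq r).
Proof.
have D00 : D 0 by move=> i; rewrite mxE; exact: zero_in.
rewrite /dyadic_seq; case: unpickle => [[p k]|]//; case: ifP => // /forallP kp.
by apply: dyadic_pt_box => // i; exact: y_ge0.
Qed.

Lemma dyadic_seq_dense s U : D s -> nbhs s U -> exists r, U (dyadic_seq r).
Proof.
move=> Ds sU.
pose L := \sum_i yd i.
have yL i : yd i <= L.
  by rewrite /L (bigD1 i)//= lerDl sumr_ge0// => l _; exact: y_ge0.
have c : (fun p => dyadic_pt yd p (dyadic_floor yd p s)) @ \oo --> s.
  apply: cvg_row => i.
  have c0 : (L * 2^-1 ^+ p : R) @[p --> \oo] --> 0.
    rewrite -[X in _ --> X](mulr0 L); apply: cvgM; first exact: cvg_cst.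
    by apply: cvg_expr; rewrite ger0_norm; lra.
  apply/cvgrPdist_le => e e0; move/cvgr0Pnorm_le : c0 => /(_ e e0).
  apply: filterS => p; apply: le_trans.
  apply: (le_trans _ (ler_norm _)); rewrite exprVn.
  by apply: dyadic_floor_dist => // l; exact: y_ge0.
have [p _ /(_ p (leqnn p)) /= hp] := c _ sU.
exists (pickle (p, [ffun i => dyadic_floor yd p s i])).
rewrite /dyadic_seq pickleK ifT; last first.
  apply/forallP => i; rewrite ffunE; apply: dyadic_floor_le => // l; exact: y_ge0.
rewrite (_ : dyadic_pt yd p _ = dyadic_pt yd p (dyadic_floor yd p s))//.
by apply/rowP => i; rewrite !mxE ffunE.
Qed.

Lemma dyadic_seq_sup (h : 'rV[R]_d -> R) s c : D s ->
  h @ within D (nbhs s) --> h s -> (forall r, h (dyadic_seq r) <= c) -> h s <= c.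
Proof.
move=> Ds hc H; rewrite leNgt; apply/negP => ch.
have : \forall u \near within D (nbhs s), c < h u by exact: (cvgr_gt _ hc).
rewrite near_withinE => sU.
have [r] := dyadic_seq_dense Ds sU.
by move=> /(_ (dyadic_seq_box r)); rewrite ltNge H.
Qed.

End Surface.

Theorem theorem3p1 (R : realType) (d m : nat) (hd : (0 < d)%N) (hm : (0 < m)%N)
    (y : 'I_(d + m) -> R) (hy : forall i, 0 <= y i <= 1)
    (j : 'I_m -> 'I_d) (f : 'I_m -> R -> R)
    (f_range : forall k,
       set_fun `[0, y (lshift m (j k))] `[0, y (rshift d k)] (f k))
    (f_decr : forall k,
       {in `[0, y (lshift m (j k))] &, nonincreasing_fun (f k)})
    (z : 'I_d -> R -> R)
    (z_range : forall i s, s \in `[0, y (lshift m i)] -> 0 < z i s)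
    (z_decr : forall i, {in `[0, y (lshift m i)] &, nonincreasing_fun (z i)})
    (prod_fz : forall s : 'rV[R]_d,
       (forall i, s ord0 i \in `[0, y (lshift m i)]) ->
       \prod_(k < m) f k (s ord0 (j k)) = \prod_(i < d) z i (s ord0 i))
    (a : 'I_d -> R -> R)
    (ha : forall i t, t \in `[0, y (lshift m i)] -> a i t = t / z i t)
    (x : 'I_d -> R) (hx : forall i, x i = a i (y (lshift m i)))
    (ainv : 'I_d -> R -> R)
    (h_ainv : forall i,
       inverse_on `[0, y (lshift m i)] `[0, x i] (a i) (ainv i))
    (dO : measure_display) (Omega : measurableType dO)
    (P : probability Omega R) (X : 'rV[R]_(d + m) -> Omega -> R)
    (hX : brownian_sheet P (fun i => `[0, y i]%classic) X)
    (dO' : measure_display) (Omega' : measurableType dO')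
    (P' : probability Omega' R) (X' : 'rV[R]_d -> Omega' -> R)
    (hX' : brownian_sheet P' (fun i => `[0, x i]%classic) X')
    (g : 'rV[R]_(d + m) -> R) (hg : {within boxG y, continuous g}) :
  let D : set 'rV[R]_d := box (fun i => `[0, x i]%classic) in
  let h (t : 'rV[R]_d) : R :=
    restrS j f g (\row_i ainv i (t ord0 i)) /
      \prod_(i < d) z i (ainv i (t ord0 i)) in
  let E := sup_lt0 (setS y j f) X g in
  let E' := sup_lt0 D X' h in
  [/\ completion_measurable P E, completion_measurable P' E' &
      completion_prob P E = completion_prob P' E'].
Proof.
move=> D h E E'.
have y0 i : 0 <= y i by have /andP[] := hy i.
pose yd i := y (lshift m i).
pose D1 : set 'rV[R]_d := box (fun i => `[0, yd i]%classic).
pose D0 : set 'rV[R]_d := [set s | D1 s /\ forall i, 0 < s ord0 i].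
pose phi := surface_pt j f.
pose tc := time_change a.
pose wt := weight z.
pose G s := g (phi s).
pose W s w := X (phi s) w.
pose W' s w := wt s * X' (tc s) w.
pose q := dyadic_seq y.
have x0 i : 0 <= x i.
  have yI : y (lshift m i) \in `[0, y (lshift m i)] by rewrite in_itv/= lexx y0.
  by rewrite hx ha// divr_ge0// ltW// z_range.
have phiD s : D1 s -> boxG y (phi s) by exact: surface_pt_box.
have tcD s : D1 s -> D (tc s) by move=> Ds; exact: (time_change_box h_ainv).
have qD r : D1 (q r) by exact: dyadic_seq_box.
have wt0 s : D1 s -> 0 < wt s by exact: (weight_gt0 z_range).
have D0D : D0 `<=` D1 by move=> s [].
have [N N0 cX] := sheet_continuous y0 hX.
have [N' N'0 cX'] := sheet_continuous x0 hX'.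
have cphi s : D0 s -> phi @ within D1 (nbhs s) --> phi s.
  exact: (surface_pt_continuous y0 f_range f_decr z_range z_decr prod_fz ha hx h_ainv).
have cG s : D0 s -> G u @[u --> within D1 (nbhs s)] --> G s.
  move=> Ds; have cg := (subspace_continuousP _ _).1 hg _ (phiD s (D0D _ Ds)).
  exact: (cvg_comp _ _ (cvg_within_comp phiD (cphi s Ds)) cg).
have EE w : E w <-> exists n, forall s, D1 s -> W s w - G s <= - n.+1%:R^-1.
  apply: (iff_trans (sup_lt0P _ _ _ _)); split=> [[n H]|[n H]]; exists n.
    by move=> s Ds; apply: H; apply/(setS_surface f_range); exists s.
  by move=> t /(setS_surface f_range)[s Ds ->]; exact: H.
have htc s : D1 s -> h (tc s) = G s / wt s.
  move=> Ds; rewrite /h.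
  have -> : \row_i ainv i (tc s ord0 i) = s.
    apply/rowP => i; rewrite !mxE; have [_ _ aK _] := h_ainv i.
    by apply: aK; exact: Ds.
  rewrite /G /phi /restrS; congr (_ / _); apply: eq_bigr => i _.
  by rewrite mxE; have [_ _ aK _] := h_ainv i; rewrite aK//; exact: Ds.
have tc_surj t : D t -> exists2 s, D1 s & tc s = t.
  move=> Dt; exists (\row_i ainv i (t ord0 i)).
    by move=> i; rewrite mxE; have [_ bI _ _] := h_ainv i; apply: bI; exact: Dt.
  by apply/rowP => i; rewrite !mxE; have [_ _ _ bK] := h_ainv i; apply: bK; exact: Dt.
have small (v : R) : 0 < v -> exists n : nat, n.+1%:R^-1 <= v.
  move=> v0; exists (Num.truncn v^-1).
  rewrite -[leRHS]invrK lef_pV2 ?posrE ?invr_gt0 ?ltr0n//.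
  by apply/ltW/truncnS_gt.
have [c [C [c0 C0 cC]]] := weight_bounds y0 z_range z_decr.
have EE' w : E' w <-> exists n, forall s, D1 s -> W' s w - G s <= - n.+1%:R^-1.
  have key s : D1 s -> W' s w - G s = wt s * (X' (tc s) w - h (tc s)).
    by move=> Ds; rewrite htc// mulrBr mulrCA divff ?mulr1// gt_eqF// wt0.
  (* The margin changes with the scale: multiplying by a weight of at least [c] keeps [c / (n + 1)],
     and dividing by a weight of at most [C] keeps [1 / ((n + 1) C)]. *)
  apply: (iff_trans (sup_lt0P _ _ _ _)); split=> [[n H]|[n H]].
    have [k hk] : exists k : nat, k.+1%:R^-1 <= c * n.+1%:R^-1 :> R.
      by apply: small; rewrite mulr_gt0// invr_gt0.
    exists k => s Ds; rewrite key//.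
    apply: (le_trans (ler_wpM2l (ltW (wt0 s Ds)) (H _ (tcD s Ds)))).
    rewrite mulrN lerN2 (le_trans hk)// ler_wpM2r ?invr_ge0//.
    by have /andP[] := cC s Ds.
  have [k hk] : exists k : nat, k.+1%:R^-1 <= n.+1%:R^-1 / C :> R.
    by apply: small; rewrite divr_gt0// invr_gt0.
  exists k => t Dt; have [s Ds <-] := tc_surj t Dt.
  have := H s Ds; rewrite key// mulrC -ler_pdivlMr ?wt0// => /le_trans; apply.
  rewrite mulNr lerN2 (le_trans hk)// ler_wpM2l ?invr_ge0// lef_pV2 ?posrE ?wt0//.
  by have /andP[] := cC s Ds.
have mW r : measurable_fun setT (W (q r)).
  by apply: (sheet_measurable hX); exact: phiD.
have mW' r : measurable_fun setT (W' (q r)).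
  by apply: measurable_funM => //; apply: (sheet_measurable hX'); exact: tcD.
have W0 s w : D1 s -> ~ D0 s -> W s w = 0.
  move=> Ds nD0; apply: (bs_zero hX); first exact: phiD.
  exact: (surface_pt_prod0 j f Ds nD0).
have W'0 s w : D1 s -> ~ D0 s -> W' s w = 0.
  move=> Ds nD0; rewrite /W' (bs_zero hX') ?mulr0//; first exact: tcD.
  exact: (time_change_prod0 ha Ds nD0).
have dense w : ~ N w -> forall s c, D0 s ->
    (forall r, W (q r) w - G (q r) <= c) -> W s w - G s <= c.
  move=> nN s e Ds; apply: (dyadic_seq_sup y0 (h := fun u => W u w - G u) (D0D _ Ds)).
  apply: cvgB; last exact: cG.
  have cx := cX w nN _ (phiD s (D0D _ Ds)).
  exact: (cvg_comp _ _ (cvg_within_comp phiD (cphi s Ds)) cx).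
have dense' w : ~ N' w -> forall s c, D0 s ->
    (forall r, W' (q r) w - G (q r) <= c) -> W' s w - G s <= c.
  move=> nN s e Ds; apply: (dyadic_seq_sup y0 (h := fun u => W' u w - G u) (D0D _ Ds)).
  apply: cvgB; last exact: cG.
  apply: cvgM; first exact: (weight_row_continuous y0 z_range z_decr ha hx h_ainv).
  have cx := cX' w nN _ (tcD s (D0D _ Ds)).
  have ct := time_change_row_continuous y0 z_range z_decr ha hx h_ainv (D0D _ Ds).
  exact: (cvg_comp _ _ (cvg_within_comp tcD ct) cx).
have [cE pE] := sup_lt0_completion qD mW W0 N0 dense EE.
have [cE' pE'] := sup_lt0_completion qD mW' W'0 N'0 dense' EE'.
split => //; rewrite pE pE'; apply: sup_lt0_completion_eq => // n e F cF.
transitivity (\int[P]_w (F (\sum_(l < n) e l * (1 * X (phi (q l)) w))%R)%:E)%E.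
  apply: eq_integral => w _; congr (F _)%:E.
  by apply: eq_bigr => l _; rewrite mul1r.
(* Scalars [1] on the left and weights on the right turn the required covariance identity into
   [surface_cov]. *)
apply: (sheet_same_law (t := phi \o q) (t' := tc \o q)
  (e := fun=> 1) (e' := wt \o q) hX hX') => //.
- by move=> r; exact: phiD.
- by move=> r; exact: tcD.
move=> r l; rewrite !mul1r.
exact: (surface_cov f_decr z_range z_decr prod_fz ha (qD r) (qD l)).
Qed.
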